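(* Let $k$ be an algebraically closed field of arbitrary characteristic, and let $H$ be a finite dimensional, semisimple, lower solvable Hopf algebra over $k$. Then $H$ is of Frobenius type; that is, the dimension over $k$ of every irreducible representation of $H$ divides $\dim_k H$.
   Context: For a Hopf algebra $A$ over $k$ with counit $\epsilon$, the augmentation ideal is $A^+ = \ker \epsilon$. With coproduct $\Delta h = \sum h_1 \otimes h_2$ and antipode $S$, a Hopf subalgebra $K$ of a Hopf algebra $H$ is normal if $\sum h_1 x S(h_2) \in K$ and $\sum S(h_1) x h_2 \in K$ for all $h \in H$ and $x \in K$; in this case $HK^+ = K^+H$ is a Hopf ideal of $H$, so that $H/HK^+$ is a Hopf algebra. A Hopf algebra $H$ over $k$ is called lower solvable if there is a finite series of Hopf subalgebras $k = H_0 \subset H_1 \subset \cdots \subset H_{t-1} \subset H_t = H$ such that, for all $1 \leq i \leq t$, $H_{i-1}$ is normal in $H_i$ and $H_i/H_iH_{i-1}^+$ is commutative. A finite dimensional Hopf algebra $H$ is semisimple if it is semisimple as a $k$-algebra. It is of Frobenius type if the dimensions of its irreducible representations all divide $\dim_k H$. *)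

(* Defs.v *)
From HB Require Import structures.
From mathcomp Require Import all_boot all_order all_algebra all_field.

Set Implicit Arguments.
Unset Strict Implicit.
Unset Printing Implicit Defensive.

Import GRing.Theory.
Local Open Scope ring_scope.

Section Tensor.
Variable k : fieldType.
Implicit Types U V W : vectType k.

(* U (x) V is modelled by matrices of coordinates in the bases vbasis {:U}     *)
(* and vbasis {:V}.                                                           *)
Definition tensor U V : vectType k := 'M[k]_(\dim {:U}, \dim {:V}).

Definition tens U V (u : U) (v : V) : tensor U V :=
  \matrix_(i, j) (coord (vbasis {:U}) i u * coord (vbasis {:V}) j v).

(* The linear map on U (x) V induced by a bilinear map f, so that             *)
(* tens_lift f (\sum_i u_i (x) v_i) = \sum_i f u_i v_i (tens_lift_tens);      *)
(* only meaningful for bilinear f.                                            *)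
Definition tens_lift U V W (f : U -> V -> W) (t : tensor U V) : W :=
  \sum_i \sum_j
     (t : 'M_(_, _)) i j *: f (vbasis {:U})`_i (vbasis {:V})`_j.

Definition tensv U V (A : {vspace U}) (B : {vspace V}) : {vspace tensor U V} :=
  <<[seq tens u v | u <- vbasis A, v <- vbasis B]>>%VS.

Lemma tens_linear_l U V (v : V) : linear (fun u : U => tens u v).
Proof.
by move=> a x y; apply/matrixP=> i j; rewrite !mxE linearP /= mulrDl mulrA.
Qed.

Lemma tens_linear_r U V (u : U) : linear (fun v : V => tens u v).
Proof.
move=> a x y; apply/matrixP=> i j.
by rewrite !mxE linearP /= mulrDr [RHS]addrC mulrCA addrC.
Qed.

Lemma tens_lift_is_linear U V W (f : U -> V -> W) : linear (tens_lift f).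
Proof.
move=> a s t; rewrite /tens_lift scaler_sumr -big_split /=.
apply: eq_bigr => i _; rewrite scaler_sumr -big_split /=.
by apply: eq_bigr => j _; rewrite !mxE scalerDl scalerA.
Qed.

Lemma tens_lift_tens U V W (f : U -> V -> W) :
    (forall v, linear (f^~ v)) -> (forall u, linear (f u)) ->
  forall u v, tens_lift f (tens u v) = f u v.
Proof.
move=> fl fr u v.
have lin_sum n (X Y : vectType k) (g : X -> Y) (c : 'I_n -> k) (x : 'I_n -> X) :
    linear g -> g (\sum_i c i *: x i) = \sum_i c i *: g (x i).
  move=> gl.
  pose h : {linear X -> Y} := HB.pack g (GRing.isLinear.Build k X Y *:%R g gl).
  rewrite -[LHS]/(h _) linear_sum; apply: eq_bigr => i _.
  by rewrite linearZ.
rewrite [in RHS](coord_vbasis (memvf u)) (lin_sum _ _ _ (f^~ v)) //.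
apply: eq_bigr => i _; rewrite [in RHS](coord_vbasis (memvf v)) lin_sum //.
by rewrite scaler_sumr; apply: eq_bigr => j _; rewrite scalerA mxE.
Qed.

Lemma tens_lift_id U V (t : tensor U V) : tens_lift (@tens U V) t = t.
Proof.
apply/matrixP => p q; rewrite /tens_lift summxE (bigD1 p) //= [X in _ + X]big1.
  rewrite addr0 summxE (bigD1 q) //= [X in _ + X]big1 => [|j /negPf jq].
    by rewrite addr0 !mxE !coord_free ?eqxx ?mulr1 // (basis_free (vbasisP _)).
  rewrite !mxE !coord_free ?(basis_free (vbasisP _)) //.
  by rewrite jq !mulr0.
move=> i /negPf ip; rewrite summxE big1 // => j _.
rewrite !mxE !coord_free ?(basis_free (vbasisP _)) //.
by rewrite ip mul0r mulr0.
Qed.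

End Tensor.

HB.mixin Record Falgebra_isHopf (k : fieldType) H of Falgebra k H := {
  comul : 'Hom(H, tensor H H);
  counit : 'Hom(H, k^o);
  antipode : 'End(H);
  comul1 : comul 1 = tens 1 1;
  comulM : forall g h,
    comul (g * h) =
      tens_lift (fun g1 g2 =>
        tens_lift (fun h1 h2 => tens (g1 * h1) (g2 * h2)) (comul h)) (comul g);
  counit1 : counit 1 = 1;
  counitM : forall g h, counit (g * h) = counit g * counit h;
  comulA : forall h,
    tens_lift (fun h1 h2 =>
      tens_lift (fun h11 h12 => tens h11 (tens h12 h2)) (comul h1)) (comul h)
    = tens_lift (fun h1 h2 => tens h1 (comul h2)) (comul h)
      :> tensor H (tensor H H);
  counitl : forall h,
    tens_lift (fun h1 h2 => (counit h1 : k) *: h2) (comul h) = h;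
  counitr : forall h,
    tens_lift (fun h1 h2 => (counit h2 : k) *: h1) (comul h) = h;
  antipodel : forall h,
    tens_lift (fun h1 h2 => antipode h1 * h2) (comul h) = (counit h : k) *: 1;
  antipoder : forall h,
    tens_lift (fun h1 h2 => h1 * antipode h2) (comul h) = (counit h : k) *: 1
}.

(* Finite-dimensional Hopf algebras over k. A term                            *)
(* tens_lift (fun h1 h2 => E) (comul h) is the Sweedler sum \sum E.           *)
#[short(type="hopfType")]
HB.structure Definition Hopf (k : fieldType) :=
  { H of Falgebra k H & Falgebra_isHopf k H }.

Section Representations.
Variables (k : fieldType) (A : falgType k).

Record repr (V : vectType k) := Repr {
  repr_fun :> {linear A -> 'End(V)};
  repr1 : repr_fun 1 = \1%VF;
  reprM : forall a b, repr_fun (a * b) = (repr_fun a \o repr_fun b)%VF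
}.

Section SubReps.
Variables (V : vectType k) (rho : repr V).

Definition subrep (W : {vspace V}) := forall a, (rho a @: W <= W)%VS.

Definition simple_subrep (W : {vspace V}) :=
  [/\ subrep W, W <> 0%VS &
      forall W' : {vspace V},
        subrep W' -> (W' <= W)%VS -> W' = 0%VS \/ W' = W].

Definition irreducible_repr := simple_subrep fullv.

Definition semisimple_repr :=
  exists (n : nat) (W : 'I_n -> {vspace V}),
    [/\ forall i, simple_subrep (W i),
        (\sum_(i < n) W i)%VS = fullv & directv (\sum_(i < n) W i)].

End SubReps.

Lemma amull_comp (a b : A) : amull (a * b) = (amull a \o amull b)%VF.
Proof. by apply/lfunP => x; rewrite comp_lfunE !lfunE /= mulrA. Qed.

Definition regular_repr : repr A := Repr (amull1 A) amull_comp.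

Definition semisimple_algebra := semisimple_repr regular_repr.

End Representations.

Section HopfTheory.
Variables (k : fieldType) (H : hopfType k).
Implicit Types K L : {vspace H}.

(* Hopf subalgebras are carried by subspaces of H and share its operations,   *)
(* so all the notions below are expressed inside H.                           *)
Definition hopf_subalgebra K :=
  [/\ 1 \in K, (K * K <= K)%VS,
      (comul @: K <= tensv K K)%VS & (antipode @: K <= K)%VS].

Definition augmentation_ideal K : {vspace H} := (K :&: lker counit)%VS.

Definition left_adjoint (h x : H) : H :=
  tens_lift (fun h1 h2 => h1 * x * antipode h2) (comul h).

Definition right_adjoint (h x : H) : H :=
  tens_lift (fun h1 h2 => antipode h1 * x * h2) (comul h).

(* Normality of K as a Hopf subalgebra of the Hopf algebra L. *)
Definition hopf_normal K L :=
  (K <= L)%VS /\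
  forall h x, h \in L -> x \in K ->
    left_adjoint h x \in K /\ right_adjoint h x \in K.

(* L / L K^+ is commutative: equality in the quotient is congruence modulo    *)
(* the ideal L K^+.                                                           *)
Definition commutative_quotient K L :=
  forall x y, x \in L -> y \in L ->
    x * y - y * x \in (L * augmentation_ideal K)%VS.

Definition lower_solvable :=
  exists (t : nat) (F : nat -> {vspace H}),
    [/\ F 0%N = 1%VS, F t = fullv,
        forall i, (i <= t)%N -> hopf_subalgebra (F i) &
        forall i, (i < t)%N ->
          hopf_normal (F i) (F i.+1) /\ commutative_quotient (F i) (F i.+1)].

Definition frobenius_type :=
  forall (V : vectType k) (rho : repr H V),
    irreducible_repr rho -> (\dim {:V} %| \dim {:H})%N.

End HopfTheory.

(* Main.v *)
Require Import Defs.
From HB Require Import structures.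
From mathcomp Require Import all_boot all_order all_algebra all_field.
From mathcomp Require Import zify.
From Stdlib Require Import Classical_Prop.

(* Let K <= L be Hopf subalgebras with L / L K^+ commutative, let d be the
   dimension of L / L K^+, and let W be a simple K-submodule of a simple
   L-module V. The L-module L (x)_K W embeds in
   L (x)_K V = (L / L K^+) (x) V, which is filtered by twists of V by characters
   of L; hence dim V divides dim (L (x)_K W). If this dimension is d dim W and
   dim L = d dim K, then dim V divides dim L as soon as dim W divides dim K, and
   one climbs the series.

   The dimension formula is a weak Nichols-Zoeller theorem, obtained by a
   maximum principle. Let f(W) be the dimension of the induced module, and let W
   be a subquotient of an H-module M for which f(W) / dim W is maximal. If M' is
   the dual of M then f(W (x) M') = f(W) dim M, so all the K-subquotients of
   W (x) M' attain the maximum; one of them is the trivial module, the line of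
   the identity in End(W), for which f = d. Hence f(W) <= d dim W always, and
   since f(V) = d dim V when V is an L-module, equality holds for
   K-submodules of L-modules. *)

Set Implicit Arguments.
Unset Strict Implicit.
Unset Printing Implicit Defensive.

(* A second import of [Defs], since mathcomp shadows [repr]. *)
Import Defs GRing.Theory.
Local Open Scope ring_scope.

(** * Sweedler sums *)

Section LinearityRules.
Variables (k : fieldType).
Implicit Types U V W X : vectType k.

Lemma linear_idf U : linear (fun x : U => x).
Proof. by []. Qed.

Lemma linear_lfun U V W (g : 'Hom(V, W)) (f : U -> V) :
  linear f -> linear (fun x => g (f x)).
Proof. by move=> lf c x y; rewrite lf linearP. Qed.

Lemma linear_map U V W (g : {linear V -> W}) (f : U -> V) :
  linear f -> linear (fun x => g (f x)).
Proof. by move=> lf c x y; rewrite lf linearP. Qed.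

Lemma linear_mull U (A : falgType k) (f : U -> A) (b : A) :
  linear f -> linear (fun x => f x * b).
Proof. by move=> lf c x y; rewrite lf mulrDl scalerAl. Qed.

Lemma linear_mulr U (A : falgType k) (f : U -> A) (b : A) :
  linear f -> linear (fun x => b * f x).
Proof. by move=> lf c x y; rewrite lf mulrDr scalerAr. Qed.

Lemma linear_scalel U V (f : U -> k^o) (v : V) :
  linear f -> linear (fun x => (f x : k) *: v).
Proof. by move=> lf c x y; rewrite lf scalerDl -scalerA. Qed.

Lemma linear_scaler U V (f : U -> V) (c : k) :
  linear f -> linear (fun x => c *: f x).
Proof.
by move=> lf a x y; rewrite lf scalerDr !scalerA [c * a]mulrC.
Qed.

Lemma linear_compl U V W X (f : U -> 'Hom(W, X)) (g : 'Hom(V, W)) :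
  linear f -> linear (fun x => (f x \o g)%VF).
Proof. by move=> lf c x y; rewrite lf comp_lfunDl comp_lfunZl. Qed.

Lemma linear_compr U V W X (f : U -> 'Hom(V, W)) (g : 'Hom(W, X)) :
  linear f -> linear (fun x => (g \o f x)%VF).
Proof. by move=> lf c x y; rewrite lf comp_lfunDr comp_lfunZr. Qed.

Lemma linear_app U V W (f : U -> 'Hom(V, W)) (v : V) :
  linear f -> linear (fun x => f x v).
Proof. by move=> lf c x y; rewrite lf add_lfunE scale_lfunE. Qed.

Lemma linear_tens_lift U V W X (f : V -> W -> X) (g : U -> tensor V W) :
  linear g -> linear (fun x => tens_lift f (g x)).
Proof. by move=> lg c x y; rewrite lg tens_lift_is_linear. Qed.

Lemma linear_tens_lift_param U V W X (f : U -> V -> W -> X) (t : tensor V W) :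
  (forall v w, linear (fun x => f x v w)) ->
  linear (fun x => tens_lift (f x) t).
Proof.
move=> lf c x y; rewrite /tens_lift scaler_sumr -big_split /=.
apply: eq_bigr => i _; rewrite scaler_sumr -big_split /=.
apply: eq_bigr => j _; rewrite lf scalerDr !scalerA.
by rewrite [c * _]mulrC.
Qed.

End LinearityRules.

Definition sw (k : fieldType) (H : hopfType k) (V : vectType k)
  (f : H -> H -> V) (h : H) : V := tens_lift f (comul h).

Section SwRules.
Variables (k : fieldType) (H : hopfType k).
Implicit Types U V W X : vectType k.

Lemma linear_sw U V (f : H -> H -> V) (g : U -> H) :
  linear g -> linear (fun x => sw f (g x)).
Proof. by move=> lg; apply: linear_tens_lift; apply: linear_lfun. Qed.

Lemma linear_sw_param U V (f : U -> H -> H -> V) h :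
  (forall a b, linear (fun x => f x a b)) ->
  linear (fun x => sw (f x) h).
Proof. exact: linear_tens_lift_param. Qed.

End SwRules.

Ltac lin := cbv beta; first
  [ assumption
  | solve [apply: linear_idf]
  | solve [apply: linear_mull; lin]
  | solve [apply: linear_mulr; lin]
  | solve [apply: linear_scaler; lin]
  | solve [apply: linear_scalel; lin]
  | solve [apply: linear_compl; lin]
  | solve [apply: linear_compr; lin]
  | solve [apply: linear_sw; lin]
  | solve [apply: linear_sw_param => ? ?; lin]
  | solve [apply: linear_lfun; lin]
  | solve [apply: linear_map; lin]
  | solve [apply: linear_app; lin] ].

Section Sweedler.
Variables (k : fieldType) (H : hopfType k).
Implicit Types (U V W X : vectType k) (h g : H).

Definition bilin U V W (f : U -> V -> W) :=
  (forall v, linear (f^~ v)) /\ (forall u, linear (f u)).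

Lemma linear_fZ V W (f : V -> W) c v : linear f -> f (c *: v) = c *: f v.
Proof.
move=> lf.
pose f' : {linear V -> W} := HB.pack f (GRing.isLinear.Build k V W *:%R f lf).
by rewrite -[LHS]/(f' _) linearZ.
Qed.

Lemma linear_fsum V W (f : V -> W) (I : Type) (r : seq I) (P : pred I) F :
  linear f -> f (\sum_(i <- r | P i) F i) = \sum_(i <- r | P i) f (F i).
Proof.
move=> lf.
pose f' : {linear V -> W} := HB.pack f (GRing.isLinear.Build k V W *:%R f lf).
by rewrite -[LHS]/(f' _) linear_sum.
Qed.

Lemma tens_lift_comp U V W X (g : W -> X) (f : U -> V -> W) t :
  linear g -> g (tens_lift f t) = tens_lift (fun u v => g (f u v)) t.
Proof.
move=> gl.
pose g' : {linear W -> X} := HB.pack g (GRing.isLinear.Build k W X *:%R g gl).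
rewrite -[LHS]/(g' _) linear_sum; apply: eq_bigr => i _.
by rewrite linear_sum; apply: eq_bigr => j _; rewrite linearZ.
Qed.

Lemma sw_comp V W (g : V -> W) (f : H -> H -> V) h :
  linear g -> g (sw f h) = sw (fun a b => g (f a b)) h.
Proof. exact: tens_lift_comp. Qed.

Lemma eq_tens_lift U V W (f f' : U -> V -> W) t :
  (forall a b, f a b = f' a b) -> tens_lift f t = tens_lift f' t.
Proof.
by move=> ff; apply: eq_bigr => i _; apply: eq_bigr => j _; rewrite ff.
Qed.

Lemma eq_sw V (f f' : H -> H -> V) h :
  (forall a b, f a b = f' a b) -> sw f h = sw f' h.
Proof. exact: eq_tens_lift. Qed.

Lemma tens_lift_pair U V W (f : U -> V -> W) (t : tensor U V) :
  tens_lift f t = \sum_(p : 'I_(\dim {:U}) * 'I_(\dim {:V}))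
    (t : 'M_(_, _)) p.1 p.2 *: f (vbasis {:U})`_p.1 (vbasis {:V})`_p.2.
Proof. by rewrite /tens_lift pair_big. Qed.

Lemma sw_exchange V (f : H -> H -> H -> H -> V) g h :
  sw (fun a b => sw (fun c d => f a b c d) h) g =
  sw (fun c d => sw (fun a b => f a b c d) g) h.
Proof.
rewrite /sw !tens_lift_pair.
under eq_bigr => p _ do rewrite tens_lift_pair scaler_sumr.
under [RHS]eq_bigr => p _ do rewrite tens_lift_pair scaler_sumr.
rewrite exchange_big /=; apply: eq_bigr => p _; apply: eq_bigr => q _.
by rewrite !scalerA mulrC.
Qed.

(** Coassociativity, pushed through the linear map [G] on $H \otimes (H \otimes H)$ induced by the
    trilinear [f]. *)
Lemma sw_assoc V (f : H -> H -> H -> V) h :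
  (forall b c, linear (fun a => f a b c)) ->
  (forall a c, linear (fun b => f a b c)) ->
  (forall a b, linear (fun c => f a b c)) ->
  sw (fun a b => sw (fun c d => f c d b) a) h =
  sw (fun a b => sw (fun c d => f a c d) b) h.
Proof.
move=> f1 f2 f3.
pose G := tens_lift (fun (a : H) (t : tensor H H) => tens_lift (f a) t).
have lG : linear G by exact: tens_lift_is_linear.
have GE a t : G (tens a t) = tens_lift (f a) t.
  rewrite /G tens_lift_tens // => [t'|u]; last exact: tens_lift_is_linear.
  by apply: linear_tens_lift_param => b c; apply: f1.
have Gt a b c : G (tens a (tens b c)) = f a b c.
  by rewrite GE tens_lift_tens.
have := congr1 G (comulA h); rewrite !(tens_lift_comp _ _ lG).
under eq_tens_lift => a b.
  rewrite (tens_lift_comp _ _ lG); under eq_tens_lift => c d do rewrite Gt.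
  over.
move=> E; refine (etrans E _); apply: eq_tens_lift => a b.
exact: GE.
Qed.

Lemma swM V (f : H -> H -> V) g h : bilin f ->
  sw f (g * h) = sw (fun a b => sw (fun c d => f (a * c) (b * d)) h) g.
Proof.
move=> [f1 f2]; rewrite {1}/sw comulM.
rewrite (tens_lift_comp _ _ (tens_lift_is_linear f)).
apply: eq_tens_lift => a b; rewrite (tens_lift_comp _ _ (tens_lift_is_linear f)).
by apply: eq_tens_lift => c d; rewrite tens_lift_tens.
Qed.

Lemma sw1 V (f : H -> H -> V) : bilin f -> sw f 1 = f 1 1.
Proof. by move=> [f1 f2]; rewrite /sw comul1 tens_lift_tens. Qed.

Lemma sw_counitl V (f : H -> V) h :
  linear f -> sw (fun a b => (counit a : k) *: f b) h = f h.
Proof.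
move=> lf; rewrite -[in RHS](counitl h) (tens_lift_comp _ _ lf).
by apply: eq_tens_lift => a b; rewrite linear_fZ.
Qed.

Lemma sw_counitr V (f : H -> V) h :
  linear f -> sw (fun a b => (counit b : k) *: f a) h = f h.
Proof.
move=> lf; rewrite -[in RHS](counitr h) (tens_lift_comp _ _ lf).
by apply: eq_tens_lift => a b; rewrite linear_fZ.
Qed.

Lemma sw_antipodel h :
  sw (fun a b => antipode a * b) h = (counit h : k) *: 1.
Proof. exact: antipodel. Qed.

Lemma sw_antipoder h :
  sw (fun a b => a * antipode b) h = (counit h : k) *: 1.
Proof. exact: antipoder. Qed.

Lemma antipode1 : antipode 1 = 1 :> H.
Proof.
have := sw_antipodel 1; rewrite counit1 scale1r sw1 ?mulr1 //.
by split=> x; lin.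
Qed.

(* The convolution inverse of [h => g * h], computed from either side. *)
Lemma antipode_mul_conv g h :
  sw (fun a b => antipode (a * h) * b) g = (counit g : k) *: antipode h.
Proof.
pose u x := sw (fun a b => antipode (a * x) * b) g.
have lu : linear u by rewrite /u; lin.
have ux x : sw (fun c d => u c * d) x = ((counit g : k) * (counit x : k)) *: 1.
  have -> : (counit g : k) * (counit x : k) = (counit (g * x) : k).
    by rewrite counitM.
  rewrite -sw_antipodel swM; last by split=> v; lin.
  rewrite sw_exchange; apply: eq_sw => c d; rewrite /u.
  rewrite (sw_comp (g := fun y => y * d)); last by lin.
  by apply: eq_sw => a b; rewrite mulrA.
(* Evaluate the convolution $u * \mathrm{id} * S$ at [h]: one bracketing gives $u(h)$, the other
   $\epsilon(g) S(h)$. *)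
rewrite -/(u h) -(sw_counitr _ lu).
have -> : sw (fun a b => (counit b : k) *: u a) h =
          sw (fun a b => sw (fun c d => u a * c * antipode d) b) h.
  apply: eq_sw => a b; under eq_sw => c d do rewrite -mulrA.
  rewrite -(sw_comp (g := fun y => u a * y)); last by lin.
  by rewrite sw_antipoder -scalerAr mulr1.
rewrite -(sw_assoc (f := fun a c d => u a * c * antipode d)); try by move=> *; lin.
have -> : sw (fun a b => sw (fun c d => u c * d * antipode b) a) h =
          sw (fun a b => (counit a : k) *: ((counit g : k) *: antipode b)) h.
  apply: eq_sw => a b.
  rewrite -(sw_comp (g := fun y => y * antipode b)); last by lin.
  by rewrite ux -scalerAl mul1r scalerA mulrC.
by rewrite (sw_counitl (f := fun b => (counit g : k) *: antipode b)) //; lin.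
Qed.

(** Expand $S(gh)$ as $\sum S(g_1 h) g_2 S(g_3)$ and rebracket; [antipode_mul_conv] collapses the
    first two factors to $\epsilon(g_1) S(h)$. *)
Lemma antipodeM g h : antipode (g * h) = antipode h * antipode g.
Proof.
rewrite -(sw_counitr (f := fun x => antipode (x * h))); last by lin.
have -> : sw (fun a b => (counit b : k) *: antipode (a * h)) g =
  sw (fun a b => sw (fun c d => antipode (a * h) * c * antipode d) b) g.
  apply: eq_sw => a b; under eq_sw => c d do rewrite -mulrA.
  rewrite -(sw_comp (g := fun y => antipode (a * h) * y)); last by lin.
  by rewrite sw_antipoder -scalerAr mulr1.
rewrite -(sw_assoc (f := fun a c d => antipode (a * h) * c * antipode d));
  try by move=> *; lin.
have -> : sw (fun a b => sw (fun c d => antipode (c * h) * d * antipode b) a) g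
        = sw (fun a b => (counit a : k) *: (antipode h * antipode b)) g.
  apply: eq_sw => a b.
  rewrite -(sw_comp (g := fun y => y * antipode b)); last by lin.
  by rewrite antipode_mul_conv scalerAl.
by rewrite (sw_counitl (f := fun b => antipode h * antipode b)) //; lin.
Qed.

Definition subcoalgebra (K : {vspace H}) := (comul @: K <= tensv K K)%VS.

(** Replaces the coordinates of [comul h], which run over a basis of all of [H], by tensors with
    both legs in [K], so that identities valid only on [K] can be used under [sw]. *)
Lemma subcoalgebra_dec K h : subcoalgebra K -> h \in K ->
  exists2 s : seq (H * H), {in s, forall p, p.1 \in K /\ p.2 \in K} &
    forall V (f : H -> H -> V), bilin f -> sw f h = \sum_(p <- s) f p.1 p.2.
Proof.
rewrite /sw.
move=> coK hK; have := subvP coK _ (memv_img comul hK).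
pose r := [seq (u, v) | u <- vbasis K, v <- vbasis K].
pose F (p : H * H) := tens p.1 p.2.
have -> : tensv K K = <<in_tuple (map F r)>>%VS.
  by rewrite /tensv /r map_allpairs.
rewrite /sw; move: (comul h) => t /coord_span tE.
have [c {}tE] : exists c : 'I_(size (map F r)) -> k,
    t = \sum_i c i *: (map F r)`_i by eexists; exact: tE.
exists [seq (c i *: (r`_i).1, (r`_i).2) |
         i : 'I_(size (map F r))].
  move=> p /mapP[i _ ->] /=.
  have ir : (i < size r)%N by rewrite -(size_map F).
  have /allpairsP[[u v] [/= uK vK ->]] := mem_nth 0 ir.
  by split; [apply: memvZ|]; apply: vbasis_mem.
move=> V f [f1 f2]; rewrite tE big_map big_enum /=.
rewrite (linear_fsum _ _ _ (tens_lift_is_linear f)).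
apply: eq_bigr => i _; rewrite (linear_fZ _ _ (tens_lift_is_linear f)).
rewrite (nth_map 0); last by rewrite -(size_map F).
by rewrite tens_lift_tens //= (linear_fZ (f := f^~ _)).
Qed.

Lemma sw_mem V (Z : {vspace V}) (f : H -> H -> V) K h :
  subcoalgebra K -> h \in K -> bilin f ->
  {in K &, forall a b, f a b \in Z} -> sw f h \in Z.
Proof.
move=> coK /(subcoalgebra_dec coK)[s sK sE] bf fZ; rewrite sE //.
rewrite big_seq_cond; apply: memv_suml => p /andP[ps _].
by have [? ?] := sK p ps; apply: fZ.
Qed.

Lemma eq_sw_in V (f f' : H -> H -> V) K h :
  subcoalgebra K -> h \in K -> bilin f -> bilin f' ->
  {in K &, forall a b, f a b = f' a b} -> sw f h = sw f' h.
Proof.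
move=> coK /(subcoalgebra_dec coK)[s sK sE] bf bf' ff; rewrite !sE //.
rewrite big_seq_cond [RHS]big_seq_cond; apply: eq_bigr => p /andP[ps _].
by have [? ?] := sK p ps; apply: ff.
Qed.
End Sweedler.

Section Linfun.
Variables (k : fieldType).
Implicit Types U V W : vectType k.

Lemma linfun_linE U V (f : U -> V) x : linear f -> linfun f x = f x.
Proof.
move=> lf.
pose f' : {linear U -> V} := HB.pack f (GRing.isLinear.Build k U V *:%R f lf).
by rewrite -[f]/(f' : U -> V) lfunE.
Qed.

End Linfun.

(** * The action of the dual algebra *)

Section Hit.
Variables (k : fieldType) (H : hopfType k).
Implicit Types (V : vectType k) (h g : H) (phi : 'Hom(H, k^o)).
Implicit Types (K L : {vspace H}).

(** The usual right action $h \leftharpoonup \varphi$ of the dual algebra on [H]. *)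
Definition hit phi h : H := sw (fun a b => (phi a : k) *: b) h.

Lemma bilin_hit phi : bilin (fun a b : H => (phi a : k) *: b).
Proof. by split=> x; lin. Qed.

Lemma linear_hit phi : linear (hit phi).
Proof. by rewrite /hit; lin. Qed.

Lemma counit_hit phi h : counit (hit phi h) = phi h.
Proof.
rewrite /hit sw_comp; last by lin.
rewrite -[RHS]sw_counitr; last by lin.
by apply: eq_sw => a b; rewrite linearZ; apply: mulrC.
Qed.

Lemma hit_counit h : hit counit h = h.
Proof. by rewrite /hit (sw_counitl (f := id)). Qed.

(** By coassociativity, $\Delta(h \leftharpoonup \varphi) = \sum (h_1 \leftharpoonup \varphi)
    \otimes h_2$. *)
Lemma sw_hit V (f : H -> H -> V) phi h : bilin f ->
  sw f (hit phi h) = sw (fun a b => f (hit phi a) b) h.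
Proof.
move=> [f1 f2]; rewrite {1}/hit (sw_comp (g := sw f)); last by lin.
under eq_sw => a b.
  rewrite linear_fZ; last by lin.
  rewrite (sw_comp (g := fun x => (phi a : k) *: x)); last by lin.
  over.
rewrite -(sw_assoc (f := fun a c d => (phi a : k) *: f c d)).
- apply: eq_sw => a b; rewrite /hit (sw_comp (g := f^~ b)); last exact: f1.
  by apply: eq_sw => c d; rewrite (linear_fZ _ _ (f1 _)).
- by move=> *; lin.
- by move=> b c; apply: linear_scaler; apply: f1.
- by move=> b c; apply: linear_scaler; apply: f2.
Qed.

Lemma hit_mem L phi h : subcoalgebra L -> h \in L -> hit phi h \in L.
Proof.
move=> coL hL; apply: (sw_mem coL hL (bilin_hit phi)) => a b _ bL.
exact: memvZ.
Qed.

Lemma hit_antipode phi h :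
  sw (fun a b => hit phi a * antipode b) h = (phi h : k) *: 1.
Proof.
rewrite -(sw_hit (f := fun a b => a * antipode b)); last by split=> x; lin.
by rewrite sw_antipoder counit_hit.
Qed.

(** In $\sum \varphi(h_1 x_1) h_2 x_2$ the factor $x_1$ leaves through $\epsilon$. This right
    [K]-linearity is what makes [ind_map] balanced over [K]. *)
Lemma hit_mulr K L phi h x : subcoalgebra K -> subcoalgebra L ->
  {in L & K, forall a c : H, phi (a * c) = (phi a : k) * (counit c : k)} ->
  h \in L -> x \in K -> hit phi (h * x) = hit phi h * x.
Proof.
move=> coK coL phiK hL xK; rewrite /hit swM; last exact: bilin_hit.
rewrite [RHS](sw_comp (g := fun y => y * x)); last by lin.
apply: (eq_sw_in coL hL); try by split=> y; lin.
move=> a b aL bL /=; rewrite -scalerAl.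
rewrite -[in RHS](sw_counitl x (f := id)) //.
rewrite [RHS](sw_comp (g := fun y : H => (phi a : k) *: (b * y : H))); last by lin.
apply: (eq_sw_in coK xK); try by split=> y; lin.
by move=> c e cK eK /=; rewrite phiK // -scalerAr scalerA.
Qed.

End Hit.

(** * The adjoint action on endomorphisms *)

Section Adjoint.
Variables (k : fieldType) (H : hopfType k).
Variables (M : vectType k) (rho : repr H M).
Implicit Types (F : 'End(M)) (h g : H).

(** This action turns ['End(M)] into the [H]-module $M \otimes M'$, with $M'$ the dual of [M]. *)
Definition hom_act h F : 'End(M) :=
  sw (fun a b => (rho a \o (F \o rho (antipode b)))%VF) h.

Lemma linear_hom_act h : linear (hom_act h).
Proof. by rewrite /hom_act; lin. Qed.

Lemma linear_hom_act_l F : linear (hom_act^~ F).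
Proof. by rewrite /hom_act; lin. Qed.

Lemma linear_hom_act_linfun : linear (fun h => linfun (hom_act h)).
Proof.
move=> c x y; apply/lfunP => F.
rewrite add_lfunE scale_lfunE !linfun_linE; try exact: linear_hom_act.
by rewrite (linear_hom_act_l F).
Qed.

Definition hom_act_linear : {linear H -> 'End('End(M))} :=
  HB.pack (fun h => linfun (hom_act h))
    (GRing.isLinear.Build k H 'End('End(M)) *:%R _ linear_hom_act_linfun).

Lemma hom_act1 : hom_act_linear 1 = \1%VF.
Proof.
apply/lfunP => F; rewrite /= linfun_linE; last exact: linear_hom_act.
rewrite /hom_act sw1; last by split=> x; lin.
by rewrite antipode1 !repr1 comp_lfun1l comp_lfun1r id_lfunE.
Qed.

Lemma hom_actM g h : hom_act_linear (g * h) =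
  (hom_act_linear g \o hom_act_linear h)%VF.
Proof.
apply/lfunP => F; rewrite comp_lfunE /= !linfun_linE; try exact: linear_hom_act.
rewrite /hom_act swM; last by split=> x; lin.
apply: eq_sw => a b.
rewrite [RHS](sw_comp (g := fun G => (rho a \o (G \o rho (antipode b)))%VF)).
  apply: eq_sw => c e; rewrite antipodeM !reprM.
  by rewrite !comp_lfunA.
by lin.
Qed.

Definition hom_repr : repr H 'End(M) := Repr hom_act1 hom_actM.

Lemma hom_reprE h F :
  hom_repr h F = sw (fun a b => (rho a \o (F \o rho (antipode b)))%VF) h.
Proof. exact/linfun_linE/linear_hom_act. Qed.

Lemma hom_repr_hit phi h F :
  hom_repr (hit phi h) F =
  sw (fun a b => (rho (hit phi a) \o (F \o rho (antipode b)))%VF) h.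
Proof. by rewrite hom_reprE sw_hit //; split=> x; lin. Qed.

(* For [F = w (x) psi] in [M (x) M'], with [M'] the dual of [M], this is
   \sum h1 (w (x) S(h2) psi) = h w (x) psi with [hit phi h] in place of [h]. *)
Lemma hom_repr_untwist phi h F :
  sw (fun a b =>
    hom_repr (hit phi a) (F \o rho (antipode (antipode b)))%VF) h =
  (rho (hit phi h) \o F)%VF.
Proof.
under eq_sw => a b do rewrite hom_repr_hit.
rewrite (sw_assoc (f := fun a c d => (rho (hit phi a) \o
   ((F \o rho (antipode (antipode d))) \o rho (antipode c)))%VF));
  try by move=> *; lin.
under eq_sw => a b.
  have -> : sw (fun c d => (rho (hit phi a) \o
    ((F \o rho (antipode (antipode d))) \o rho (antipode c)))%VF) b =
    (rho (hit phi a) \o (F \o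
      rho (antipode (sw (fun c d => c * antipode d) b))))%VF.
    rewrite (sw_comp (g := fun x => (rho (hit phi a) \o (F \o
      rho (antipode x)))%VF)); last by lin.
    by apply: eq_sw => c d; rewrite antipodeM reprM !comp_lfunA.
  rewrite sw_antipoder linear_fZ; last by lin.
  rewrite antipode1 linearZ /= repr1 -!comp_lfunZr comp_lfun1r; over.
rewrite (sw_counitr (f := fun a => (rho (hit phi a) \o F)%VF)) //.
by apply: linear_compl; apply: linear_map; exact: linear_hit.
Qed.

End Adjoint.

(** * Induction from a Hopf subalgebra *)

Section ValuedIn.
Variables (k : fieldType).
Implicit Types V W : vectType k.

(** Built as the image of an injective map, which yields its dimension. When [V] and [W] are both
    [M], it is $Z \otimes M'$ inside ['End(M)]. *)
Definition hom_in V W (Z : {vspace W}) : {vspace 'Hom(V, W)} :=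
  limg (linfun (fun F : 'Hom(V, subvs_of Z) => (linfun vsval \o F)%VF)).

Let linear_hom_in V W (Z : {vspace W}) :
  linear (fun F : 'Hom(V, subvs_of Z) => (linfun vsval \o F)%VF).
Proof. by lin. Qed.

Lemma hom_inP V W (Z : {vspace W}) (F : 'Hom(V, W)) :
  reflect (forall v, F v \in Z) (F \in hom_in V Z).
Proof.
apply: (iffP idP) => [/memv_imgP[G _ ->] v|FZ].
  rewrite linfun_linE; last exact: linear_hom_in.
  by rewrite comp_lfunE lfunE; apply: subvsP.
suff -> : F = linfun (fun F : 'Hom(V, subvs_of Z) => (linfun vsval \o F)%VF)
                     (linfun (vsproj Z) \o F)%VF by exact/memv_img/memvf.
apply/lfunP => v; rewrite linfun_linE; last exact: linear_hom_in.
by rewrite !comp_lfunE !lfunE /= vsprojK.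
Qed.

Lemma dim_hom_in V W (Z : {vspace W}) :
  \dim (hom_in V Z) = (\dim {:V} * \dim Z)%N.
Proof.
rewrite limg_dim_eq ?dimvf //; apply/eqP; rewrite -subv0; apply/subvP => F.
rewrite memv_cap memvf memv_ker memv0 => /eqP F0; apply/eqP/lfunP => v.
have := congr1 (fun G : 'Hom(V, W) => G v) F0.
rewrite linfun_linE; last exact: linear_hom_in.
rewrite comp_lfunE !zero_lfunE lfunE /= => Fv.
by apply: subvs_inj; rewrite Fv linear0.
Qed.

Variable d : nat.

Definition ffun_in V (Z : {vspace V}) : {vspace {ffun 'I_d -> V}} :=
  limg (linfun (fun F : {ffun 'I_d -> subvs_of Z} => [ffun i => vsval (F i)])).

Let linear_ffun_in V (Z : {vspace V}) :
  linear (fun F : {ffun 'I_d -> subvs_of Z} => [ffun i => vsval (F i)]).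
Proof. by move=> c F G; apply/ffunP => i; rewrite !ffunE linearP. Qed.

Lemma ffun_inP V (Z : {vspace V}) (F : {ffun 'I_d -> V}) :
  reflect (forall i, F i \in Z) (F \in ffun_in Z).
Proof.
apply: (iffP idP) => [/memv_imgP[G _ ->] v|FZ].
  rewrite linfun_linE; last exact: linear_ffun_in.
  by rewrite ffunE; apply: subvsP.
suff -> : F = linfun (fun F : {ffun 'I_d -> subvs_of Z} =>
                        [ffun i => vsval (F i)]) [ffun i => vsproj Z (F i)].
  exact/memv_img/memvf.
apply/ffunP => i; rewrite linfun_linE; last exact: linear_ffun_in.
by rewrite !ffunE vsprojK.
Qed.

Lemma dim_ffun_in V (Z : {vspace V}) : \dim (ffun_in Z) = (d * \dim Z)%N.
Proof.
rewrite limg_dim_eq.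
  rewrite dimvf. transitivity (#|'I_d| * \dim Z)%N => //. by rewrite card_ord.
apply/eqP; rewrite -subv0; apply/subvP => F.
rewrite memv_cap memvf memv_ker memv0 => /eqP F0; apply/eqP/ffunP => i.
have := congr1 (fun G : {ffun 'I_d -> V} => G i) F0.
rewrite linfun_linE; last exact: linear_ffun_in.
rewrite !ffunE => Fv.
by apply: subvs_inj; rewrite Fv linear0.
Qed.

End ValuedIn.

Section Induced.
Variables (k : fieldType) (H : hopfType k) (L : {vspace H}).
Variables (d : nat) (phi : 'I_d -> 'Hom(H, k^o)).

Section Def.
Variables (M : vectType k) (rho : repr H M).
Implicit Types W : {vspace M}.

(** When [phi] is a basis of the dual of $L/LK^+$, this is $h \mapsto \sum \bar h_1 \otimes h_2 w$,
    written in the basis of $L/LK^+$ dual to [phi]. *)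
Definition ind_map (w : M) : 'Hom(H, {ffun 'I_d -> M}) :=
  linfun (fun h => [ffun i => rho (hit (phi i) h) w]).

Lemma linear_ind_map w : linear (fun h => [ffun i => rho (hit (phi i) h) w]).
Proof.
move=> c x y; apply/ffunP => i; rewrite !ffunE linear_hit linearP /=.
by rewrite add_lfunE scale_lfunE.
Qed.

Lemma ind_mapE w h i : ind_map w h i = rho (hit (phi i) h) w.
Proof. by rewrite linfun_linE ?ffunE //; apply: linear_ind_map. Qed.

Lemma linear_ind_mapr h : linear (ind_map^~ h).
Proof. by move=> c x y; apply/ffunP => i; rewrite !(ffunE, ind_mapE) linearP. Qed.

(* When [phi] is a basis of the dual of [L / L K^+], this is the image of     *)
(* [L (x)_K W] in [(L / L K^+) (x) M].                                        *)
Definition induced W : {vspace {ffun 'I_d -> M}} :=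
  (\sum_(i < \dim W) ind_map (vbasis W)`_i @: L)%VS.

Lemma mem_induced W w h : w \in W -> h \in L -> ind_map w h \in induced W.
Proof.
move=> wW hL; rewrite (coord_vbasis wW).
rewrite (linear_fsum _ _ _ (linear_ind_mapr h)).
apply: memv_suml => i _; rewrite (linear_fZ _ _ (linear_ind_mapr h)).
apply: memvZ; rewrite /induced (bigD1 i) //=.
by apply: subvP (addvSl _ _) _ _; apply: memv_img.
Qed.

Lemma induced_sub W (Y : {vspace {ffun 'I_d -> M}}) :
  (forall w h, w \in W -> h \in L -> ind_map w h \in Y) -> (induced W <= Y)%VS.
Proof.
move=> WY; apply/subv_sumP => i _; apply/subvP => _ /memv_imgP[h hL ->].
by apply: WY => //; apply/vbasis_mem/mem_nth; rewrite size_tuple.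
Qed.

Lemma inducedS W1 W2 : (W1 <= W2)%VS -> (induced W1 <= induced W2)%VS.
Proof.
by move=> /subvP W12; apply: induced_sub => w h /W12; apply: mem_induced.
Qed.

Lemma induced_add W1 W2 : (induced (W1 + W2) <= induced W1 + induced W2)%VS.
Proof.
apply: induced_sub => _ h /memv_addP[w1 w1W [w2 w2W ->]] hL.
have := linear_ind_mapr h 1 w1 w2; rewrite !scale1r => ->.
by apply: memv_add; apply: mem_induced.
Qed.

Lemma dim_induced_le W : (\dim (induced W) <= \dim L * \dim W)%N.
Proof.
apply: leq_trans (dimv_leq_sum _ _ _) _.
rewrite mulnC -[X in (_ <= X * _)%N]card_ord -sum_nat_const.
apply: leq_sum => i _.
by rewrite -(limg_ker_dim (ind_map (vbasis W)`_i) L) leq_addl.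
Qed.

End Def.
End Induced.

Section InducedHom.
Variables (k : fieldType) (H : hopfType k) (L : {vspace H}).
Variables (d : nat) (phi : 'I_d -> 'Hom(H, k^o)).
Hypothesis coL : subcoalgebra L.
Variables (M : vectType k) (rho : repr H M).
Implicit Types (W : {vspace M}) (F : 'End(M)).

Lemma linear_ind_map_arg (U : vectType k) (f : U -> M) h :
  linear f -> linear (fun x => ind_map phi rho (f x) h).
Proof. by move=> lf c x y; rewrite lf linear_ind_mapr. Qed.

Lemma linear_ffun_app (U V : vectType k) (f : U -> {ffun 'I_d -> V}) i :
  linear f -> linear (fun x => f x i).
Proof. by move=> lf c x y; rewrite lf !ffunE. Qed.

Lemma sw_ffunE (V : vectType k) (f : H -> H -> {ffun 'I_d -> V}) h i :
  sw f h i = sw (fun a b => f a b i) h.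
Proof.
rewrite (sw_comp (g := fun y : {ffun 'I_d -> V} => y i)) //.
exact: linear_ffun_app.
Qed.

Definition stable (A : {vspace H}) W :=
  forall a w, a \in A -> w \in W -> rho a w \in W.

(** By the antipode axiom $\sum c_{i,1} \otimes S(c_{i,2}) w$ is sent to $\bar c_i \otimes w$, so
    every tensor is reached. *)
Lemma induced_stable (c : 'I_d -> H) W :
  (antipode @: L <= L)%VS -> (forall i, c i \in L) ->
  (forall i j, phi i (c j) = (i == j)%:R) -> stable L W ->
  induced L phi rho W = ffun_in d W.
Proof.
move=> /subvP SL cL phic sW; apply/eqP; rewrite eqEsubv; apply/andP; split.
  apply: induced_sub => w h wW hL; apply/ffun_inP => i.
  by rewrite ind_mapE; apply: sW => //; apply: hit_mem.
apply/subvP => F /ffun_inP FW.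
have -> : F = \sum_i sw (fun a b => ind_map phi rho
                             (rho (antipode b) (F i)) a) (c i).
  apply/ffunP => j; rewrite sum_ffunE (bigD1 j) //= sw_ffunE.
  have E i : sw (fun a b => ind_map phi rho (rho (antipode b) (F i)) a j) (c i)
    = (j == i)%:R *: F i.
    under eq_sw => a b do rewrite ind_mapE -comp_lfunE -reprM.
    rewrite -(sw_comp (g := fun x => rho x (F i))); last by lin.
    by rewrite hit_antipode phic linearZ /= repr1 scale_lfunE id_lfunE.
  rewrite E eqxx scale1r big1 ?addr0 // => i /negPf ij.
  by rewrite sw_ffunE E eq_sym ij scale0r.
apply: memv_suml => i _; apply: (sw_mem coL (cL i)).
  by split=> x; [lin|apply: linear_ind_map_arg; lin].
move=> a b aL bL; apply: mem_induced => //; apply: sW => //.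
exact/SL/memv_img.
Qed.

Definition hom_ffun (G : 'Hom(M, {ffun 'I_d -> M})) : {ffun 'I_d -> 'End(M)} :=
  [ffun i => linfun (fun m => G m i)].

Lemma hom_ffunE G i m : hom_ffun G i m = G m i.
Proof.
by rewrite ffunE linfun_linE //; apply: linear_ffun_app; lin.
Qed.

Lemma linear_hom_ffun : linear hom_ffun.
Proof.
move=> c F G; apply/ffunP => i; apply/lfunP => m.
by rewrite !(hom_ffunE, ffunE, add_lfunE, scale_lfunE).
Qed.

Definition rank1 (U V : vectType k) (y : V) (psi : 'Hom(U, k^o)) : 'Hom(U, V) :=
  linfun (fun m => (psi m : k) *: y).

Lemma rank1E (U V : vectType k) (y : V) (psi : 'Hom(U, k^o)) m :
  rank1 y psi m = (psi m : k) *: y.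
Proof. by apply: linfun_linE; lin. Qed.

Lemma linear_rank1 (U V : vectType k) (psi : 'Hom(U, k^o)) :
  linear (fun y : V => rank1 y psi).
Proof.
move=> c x y; apply/lfunP => m; rewrite !(rank1E, add_lfunE, scale_lfunE).
by rewrite scalerDr !scalerA mulrC.
Qed.

(* With [M'] the dual of [M], this says that inducing [W (x) M'] amounts to
   inducing [W] and then tensoring with [M']. *)
Lemma induced_hom W :
  induced L phi (hom_repr rho) (hom_in M W) =
  (linfun hom_ffun @: hom_in M (induced L phi rho W))%VS.
Proof.
apply/eqP; rewrite eqEsubv; apply/andP; split.
  apply: induced_sub => F h /hom_inP FW hL.
  (* The adjoint action precomposes with $S(h_2)$, so the generator given by [F] and [h], read as a
     function of [m], is a sum of generators of [induced L phi rho W]. *)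
  pose g m := sw (fun a b => ind_map phi rho (F (rho (antipode b) m)) a) h.
  have lg : linear g by apply: linear_sw_param => a b; apply: linear_ind_map_arg; lin.
  have -> : ind_map phi (hom_repr rho) F h = linfun hom_ffun (linfun g).
    rewrite (linfun_linE _ linear_hom_ffun).
    apply/ffunP => i; apply/lfunP => m; rewrite hom_ffunE (linfun_linE _ lg) sw_ffunE.
    rewrite ind_mapE hom_repr_hit (sw_comp (g := fun G : 'End(M) => G m)); last by lin.
    by apply: eq_sw => a b; rewrite ind_mapE !comp_lfunE.
  apply: memv_img; apply/hom_inP => m; rewrite (linfun_linE _ lg).
  apply: (sw_mem coL hL); first by split=> x; [lin|apply: linear_ind_map_arg; lin].
  by move=> a b aL _; apply: mem_induced.
apply/subvP => _ /memv_imgP[G /hom_inP GW ->].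
rewrite (linfun_linE _ linear_hom_ffun).
have lr psi : linear (fun y => hom_ffun (rank1 y psi)).
  by move=> c x y; rewrite linear_rank1 linear_hom_ffun.
(* Conversely, on an elementary tensor $y \otimes \psi$ the twist by $S(h_2)$ is undone with
   [hom_repr_untwist]; a general [G] is a sum of such tensors. *)
have mem1 y psi : y \in induced L phi rho W ->
    hom_ffun (rank1 y psi) \in induced L phi (hom_repr rho) (hom_in M W).
  rewrite -(linfun_linE _ (lr psi)) memv_preim; apply: subvP.
  apply: induced_sub => w h wW hL; rewrite -memv_preim (linfun_linE _ (lr psi)).
  pose F := rank1 w psi.
  have -> : hom_ffun (rank1 (ind_map phi rho w h) psi) =
     sw (fun a b => ind_map phi (hom_repr rho)
                      (F \o rho (antipode (antipode b)))%VF a) h.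
    apply/ffunP => i; rewrite sw_ffunE; under eq_sw => a b do rewrite ind_mapE.
    rewrite hom_repr_untwist; apply/lfunP => m.
    by rewrite hom_ffunE comp_lfunE !rank1E ffunE ind_mapE linearZ.
  apply: (sw_mem coL hL).
    split=> x; first by lin.
    by move=> c u v; rewrite !linearP /= comp_lfunDr -comp_lfunZr linear_ind_mapr.
  move=> a b aL _; apply: mem_induced => //; apply/hom_inP => m.
  by rewrite comp_lfunE rank1E memvZ.
have -> : G = \sum_(j < \dim {:M})
    rank1 (G (vbasis {:M})`_j) (linfun (coord (vbasis {:M}) j : M -> k^o)).
  apply/lfunP => m; rewrite [in LHS](coord_vbasis (memvf m)) linear_sum sum_lfunE.
  apply: eq_bigr => j _; rewrite rank1E linearZ linfun_linE //.
  by move=> c x y; rewrite linearP.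
rewrite (linear_fsum _ _ _ linear_hom_ffun).
by apply: memv_suml => j _; apply: mem1.
Qed.

Lemma dim_induced_hom W :
  \dim (induced L phi (hom_repr rho) (hom_in M W)) =
  (\dim {:M} * \dim (induced L phi rho W))%N.
Proof.
rewrite induced_hom limg_dim_eq ?dim_hom_in //.
apply/eqP; rewrite -subv0; apply/subvP => G; rewrite memv_cap => /andP[_].
rewrite memv_ker memv0 (linfun_linE _ linear_hom_ffun).
move=> /eqP G0; apply/eqP/lfunP => m; apply/ffunP => i.
by rewrite -hom_ffunE G0 zero_lfunE !ffunE zero_lfunE.
Qed.

End InducedHom.

(** * The maximum principle *)

Section Freeness.
Variables (k : fieldType) (H : hopfType k) (K L : {vspace H}).
Hypotheses (hopfK : hopf_subalgebra K) (hopfL : hopf_subalgebra L).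
Hypothesis (sKL : (K <= L)%VS).

(** [c] lifts a basis of $L/LK^+$, and [phi] extends the dual basis to functionals on [H]; thus [d]
    is the dimension of $L/LK^+$. *)
Definition cobasis d (c : 'I_d -> H) (phi : 'I_d -> 'Hom(H, k^o)) :=
  [/\ forall i, c i \in L,
      forall i j, phi i (c j) = (i == j)%:R,
      forall i h, h \in (L * augmentation_ideal K)%VS -> phi i h = 0 &
      forall h, h \in L ->
        h - \sum_i (phi i h : k) *: c i \in (L * augmentation_ideal K)%VS].

Variables (d : nat) (c : 'I_d -> H) (phi : 'I_d -> 'Hom(H, k^o)).
Hypothesis cphi : cobasis c phi.

Let K1 : 1 \in K. Proof. by case: hopfK. Qed.
Let KK : {in K &, forall a b, a * b \in K}.
Proof. by case: hopfK => _ /subvP s _ _ a b aK bK; apply/s/memv_mul. Qed.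
Let coK : subcoalgebra K. Proof. by case: hopfK. Qed.
Let SK : {in K, forall a, antipode a \in K}.
Proof. by case: hopfK => _ _ _ /subvP s a aK; apply/s/memv_img. Qed.
Let LL : {in L &, forall a b, a * b \in L}.
Proof. by case: hopfL => _ /subvP s _ _ a b aL bL; apply/s/memv_mul. Qed.
Let coL : subcoalgebra L. Proof. by case: hopfL. Qed.
Let SL : (antipode @: L <= L)%VS. Proof. by case: hopfL. Qed.

Lemma augP y : (y \in augmentation_ideal K) = (y \in K) && (counit y == 0).
Proof. by rewrite memv_cap memv_ker. Qed.

Lemma cobasis_mulr i : {in L & K, forall a b : H,
  phi i (a * b) = (phi i a : k) * (counit b : k)}.
Proof.
move=> a b aL bK; case: cphi => _ _ phi0 _.
have : phi i (a * (b - (counit b : k) *: 1)) = 0.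
  apply/phi0/memv_mul => //; rewrite augP rpredB ?rpredZ //=.
  by rewrite linearB linearZ /= counit1 subr_eq0 [_ *: _]mulr1.
rewrite mulrBr linearB /= -scalerAr mulr1 linearZ /= => /eqP.
by rewrite subr_eq0 => /eqP ->; apply: mulrC.
Qed.

Lemma ind_map_mulr (M : vectType k) (rho : repr H M) w h x :
  h \in L -> x \in K ->
  ind_map phi rho w (h * x) = ind_map phi rho (rho x w) h.
Proof.
move=> hL xK; apply/ffunP => i; rewrite !ind_mapE.
rewrite (hit_mulr coK coL _ hL xK) ?reprM ?comp_lfunE //.
exact: cobasis_mulr.
Qed.

Section Jump.
Variables (M : vectType k) (rho : repr H M) (W1 W2 : {vspace M}).
Hypotheses (sW1 : stable rho K W1) (sW2 : stable rho K W2).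

(* [N / N'] is [End(W2 / W1)] where [N'] is the subspace of those maps in     *)
(* [Hom(M, W2)] sending [W2] to [W1]; modulo [N'] the projection onto [W2]    *)
(* is the identity of [W2 / W1], hence a trivial [K]-submodule.               *)
Definition trans_in : {vspace 'End(M)} :=
  (hom_in M W2 :&:
    linfun (fun F : 'End(M) => (F \o projv W2)%VF) @^-1: hom_in M W1)%VS.

Lemma trans_inP (F : 'End(M)) :
  reflect ((forall m, F m \in W2) /\ forall w, w \in W2 -> F w \in W1)
          (F \in trans_in).
Proof.
have lp : linear (fun F : 'End(M) => (F \o projv W2)%VF) by lin.
rewrite memv_cap -memv_preim (linfun_linE _ lp).
apply: (iffP andP) => [[/hom_inP F2 /hom_inP F1]|[F2 F1]]; split=> //.
- by move=> w wW; have := F1 w; rewrite comp_lfunE projv_id.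
- exact/hom_inP.
- by apply/hom_inP => m; rewrite comp_lfunE; apply/F1/memv_proj.
Qed.

Lemma hom_repr_app h F m :
  hom_repr rho h F m = sw (fun a b => rho a (F (rho (antipode b) m))) h.
Proof.
rewrite hom_reprE (sw_comp (g := fun G : 'End(M) => G m)); last by lin.
by apply: eq_sw => a b; rewrite !comp_lfunE.
Qed.

Lemma stable_hom_in W : stable rho K W -> stable (hom_repr rho) K (hom_in M W).
Proof.
move=> sW h F hK /hom_inP FW; apply/hom_inP => m; rewrite hom_repr_app.
apply: (sw_mem coK hK); first by split=> x; lin.
by move=> a b aK bK; apply: sW.
Qed.

Lemma stable_trans_in : stable (hom_repr rho) K trans_in.
Proof.
move=> h F hK /trans_inP[F2 F1]; apply/trans_inP; split=> [m|w wW].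
  by apply/hom_inP; apply: stable_hom_in => //; apply/hom_inP.
rewrite hom_repr_app; apply: (sw_mem coK hK); first by split=> x; lin.
move=> a b aK bK; apply: sW1 => //; apply: F1.
by apply: sW2 => //; apply: SK.
Qed.

Lemma proj_trivial h : h \in K ->
  hom_repr rho h (projv W2) - (counit h : k) *: projv W2 \in trans_in.
Proof.
move=> hK; have PW : projv W2 \in hom_in M W2.
  by apply/hom_inP => m; apply: memv_proj.
apply/trans_inP; split=> [m|w wW].
  apply/hom_inP; rewrite rpredB ?rpredZ //; exact: stable_hom_in.
rewrite add_lfunE opp_lfunE scale_lfunE projv_id // hom_repr_app.
suff -> : sw (fun a b => rho a (projv W2 (rho (antipode b) w))) h =
          (counit h : k) *: w by rewrite subrr mem0v.
transitivity (rho (sw (fun a b => a * antipode b) h) w).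
  rewrite (sw_comp (g := fun x => rho x w)); last by lin.
  apply: (eq_sw_in coK hK); try by split=> x; lin.
  move=> a b aK bK; rewrite projv_id; last by apply: sW2 => //; apply: SK.
  by rewrite reprM comp_lfunE.
by rewrite sw_antipoder linearZ /= repr1 scale_lfunE id_lfunE.
Qed.

Lemma stable_trans_in_proj :
  stable (hom_repr rho) K (trans_in + <[projv W2]>)%VS.
Proof.
move=> h _ hK /memv_addP[F FN [_ /vlineP[a ->] ->]].
rewrite linearD linearZ /= rpredD //.
  exact: subvP (addvSl _ _) _ (stable_trans_in hK FN).
rewrite rpredZ // -[hom_repr _ _ _](subrK ((counit h : k) *: projv W2)).
by rewrite memv_add ?proj_trivial // rpredZ // memv_line.
Qed.

(** Elements of $K^+$ send [projv W2] into [trans_in]. Modulo [X] the map [I] therefore kills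
    $LK^+$, and the image of [L] is spanned by the [d] vectors [I (c i)]: the trivial module has
    induced dimension at most [d]. *)
Lemma dim_induced_proj :
  (\dim (induced L phi (hom_repr rho) (trans_in + <[projv W2]>)) <=
   \dim (induced L phi (hom_repr rho) trans_in) + d)%N.
Proof.
set I := ind_map phi (hom_repr rho) (projv W2).
set X := induced _ _ _ trans_in.
have IQ : (I @: (L * augmentation_ideal K) <= X)%VS.
  apply/subvP => _ /memv_imgP[q qQ ->]; move: qQ; rewrite memv_preim.
  apply: subvP; apply/prodvP => x y xL; rewrite augP => /andP[yK /eqP y0].
  rewrite -memv_preim ind_map_mulr //; apply: mem_induced => //.
  by have := proj_trivial yK; rewrite y0 scale0r subr0.
have IL : (I @: L <= X + <<[seq I (c i) | i : 'I_d]>>)%VS.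
  apply/subvP => _ /memv_imgP[h hL ->]; case: cphi => _ _ _ cQ.
  rewrite -[h](subrK (\sum_i (phi i h : k) *: c i)) linearD /=.
  apply: memv_add; first exact: (subvP IQ) (memv_img _ (cQ h hL)).
  rewrite linear_sum; apply: memv_suml => i _; rewrite linearZ /= memvZ //.
  by apply: memv_span; apply: image_f.
apply: (@leq_trans (\dim (X + <<[seq I (c i) | i : 'I_d]>>))).
  apply: dimvS; apply: subv_trans (induced_add _ _ _ _ _) _.
  rewrite subv_add addvSl /=; apply: induced_sub => _ h /vlineP[a ->] hL.
  rewrite (linear_fZ _ _ (linear_ind_mapr _ _ _)) memvZ //.
  exact: (subvP IL) (memv_img _ hL).
rewrite -(leq_add2r (\dim (X :&: <<[seq I (c i) | i : 'I_d]>>))).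
rewrite dimv_sum_cap -addnA leq_add2l (leq_trans (dim_span _)) //.
by rewrite size_image card_ord leq_addr.
Qed.

End Jump.

Let m := \dim K.
Let f := m`!%N.

(* Jumps of [induced] are at most [s / f] times the codimension. Taking [f = m!]
   makes [f] divisible by the codimensions up to [m], which suffice: the maximum
   of the ratio is then reached by descending on the integer [s]. *)
Definition jump_bound (s : nat) := forall (M : vectType k) (rho : repr H M)
  (W1 W2 : {vspace M}), stable rho K W1 -> stable rho K W2 -> (W1 <= W2)%VS ->
  (\dim (induced L phi rho W2) * f + s * \dim W1 <=
   \dim (induced L phi rho W1) * f + s * \dim W2)%N.

(** Starting point of the descent: [induced] is subadditive, and each new dimension adds at most
    [\dim L]. *)
Lemma jump_bound_trivial j : jump_bound (\dim L * f + j).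
Proof.
move=> M rho W1 W2 _ _ W12.
have W2E : (W1 + (W2 :\: W1))%VS = W2.
  by rewrite addvC addv_diff; apply/addv_idPl.
have dW2 : (\dim W2 = \dim W1 + \dim (W2 :\: W1))%N.
  by rewrite -(dimv_cap_compl W2 W1) (capv_idPr W12).
have : (\dim (induced L phi rho W2) <=
        \dim (induced L phi rho W1) + \dim L * \dim (W2 :\: W1))%N.
  rewrite -[in X in (X <= _)%N]W2E.
  apply: leq_trans (dimvS (induced_add _ _ _ _ _)) _.
  rewrite -(leq_add2r (\dim (induced L phi rho W1 :&: induced L phi rho (W2 :\: W1)))).
  rewrite dimv_sum_cap -addnA leq_add2l.
  by apply: leq_trans (dim_induced_le _ _ _ _) (leq_addr _ _).
rewrite dW2; clear; nia.
Qed.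

(** [W2] is reached from [W1] by adjoining cyclic submodules $Kv$, each of dimension at most [m],
    and the inequalities add up. *)
Lemma jump_bound_refine s :
  (forall (M : vectType k) (rho : repr H M) (W1 W2 : {vspace M}),
    stable rho K W1 -> stable rho K W2 -> (W1 <= W2)%VS ->
    (\dim W2 <= \dim W1 + m)%N ->
    (\dim (induced L phi rho W2) * f + s * \dim W1 <=
     \dim (induced L phi rho W1) * f + s * \dim W2)%N) ->
  jump_bound s.
Proof.
move=> small M rho W1 W2 sW1 sW2.
move: {2}(\dim W2 - \dim W1)%N (leqnn (\dim W2 - \dim W1)) => n.
elim: n => [|n IHn] in W1 sW1 * => dW W12.
  have -> : W1 = W2 by apply/eqP; rewrite eqEdim W12 -subn_eq0 -leqn0.
  exact: leqnn.
have [/subvP W21|/subvPn[v v2 v1]] := boolP (W2 <= W1)%VS.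
  have -> : W1 = W2 by apply/eqP; rewrite eqEsubv W12; apply/subvP.
  exact: leqnn.
pose Kv := (linfun (fun a => rho a v) @: K)%VS.
have lv : linear (fun a => rho a v) by lin.
pose W := (W1 + Kv)%VS.
have sW : stable rho K W.
  move=> a _ aK /memv_addP[w wW [_ /memv_imgP[b bK ->] ->]].
  rewrite linearD /= memv_add ?sW1 // (linfun_linE _ lv) -comp_lfunE -reprM.
  by rewrite -(linfun_linE _ lv) memv_img // KK.
have W1W : (W1 <= W)%VS by apply: addvSl.
have WW2 : (W <= W2)%VS.
  rewrite subv_add W12; apply/subvP => _ /memv_imgP[b bK ->].
  by rewrite (linfun_linE _ lv) sW2.
have dWm : (\dim W <= \dim W1 + m)%N.
  rewrite -(leq_add2r (\dim (W1 :&: Kv))) dimv_sum_cap -addnA leq_add2l.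
  rewrite /m -(limg_ker_dim (linfun (fun a => rho a v)) K).
  by rewrite -addnA addnCA leq_addr.
have dW1 : (\dim W1 < \dim W)%N.
  rewrite ltn_neqAle dimvS // andbT; apply/negP => /eqP dE.
  have /eqP W1E : W1 == W by rewrite eqEdim W1W dE leqnn.
  case/negP: v1; rewrite W1E; apply: (subvP (addvSr _ _)).
  have := memv_img (linfun (fun a => rho a v)) K1.
  by rewrite (linfun_linE _ lv) repr1 id_lfunE.
have dWn : (\dim W2 - \dim W <= n)%N.
  by rewrite -ltnS (leq_trans _ dW) // ltn_sub2l // (leq_trans dW1) ?dimvS.
have add (u r x y z t : nat) :
    (u + r <= x + y -> x + z <= t + r -> u + z <= t + y)%N by clear; lia.
exact: add (IHn W sW dWn WW2) (small M rho W1 W sW1 sW W1W dWm).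
Qed.

(** In the chain [hom_in M W1 <= N <= N + P <= hom_in M W2] the outer links obey the bound for
    [s.+1], while the middle one, of codimension 1, costs at most [d * f], less than [s.+1].
    Dividing by [\dim {:M}] leaves a strict bound for the jump from [W1] to [W2]. *)
Lemma jump_bound_step s : (d * f <= s)%N -> jump_bound s.+1 -> jump_bound s.
Proof.
move=> ds Qs; apply: jump_bound_refine => M rho W1 W2 sW1 sW2 W12 dW.
have [dWle|dWlt] := leqP (\dim W2) (\dim W1).
  have -> : W1 = W2 by apply/eqP; rewrite eqEdim W12.
  exact: leqnn.
pose N := trans_in W1 W2; pose P := <[projv W2]>%VS.
have sN := stable_trans_in sW1 sW2 : stable (hom_repr rho) K N.
have sNP := stable_trans_in_proj sW1 sW2 : stable (hom_repr rho) K (N + P)%VS.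
have W1N : (hom_in M W1 <= N)%VS.
  apply/subvP => F /hom_inP F1; apply/trans_inP; split=> // x.
  exact/(subvP W12).
have NPW2 : (N + P <= hom_in M W2)%VS.
  rewrite subv_add capvSl; apply/subvP => _ /vlineP[a ->].
  by rewrite rpredZ //; apply/hom_inP => x; apply: memv_proj.
have dNP : \dim (N + P) = (\dim N).+1.
  have PN : projv W2 \notin N.
    apply/negP => /trans_inP[_ P1].
    suff /dimvS : (W2 <= W1)%VS by rewrite leqNgt dWlt.
    by apply/subvP => w wW; rewrite -(projv_id wW) P1.
  have P0 : projv W2 != 0 by apply: contraNneq PN => ->; apply: mem0v.
  rewrite dimv_disjoint_sum ?dim_vline ?P0 ?addn1 //.
  apply/eqP; rewrite -subv0; apply/subvP => F /memv_capP[FN /vlineP[a Fa]].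
  move: FN; rewrite Fa; have [-> _|a0 FN] := eqVneq a 0; first by rewrite scale0r mem0v.
  by case/negP: PN; rewrite -(scale1r (projv W2)) -(mulVf a0) -scalerA rpredZ.
have := Qs _ _ _ _ (stable_hom_in sW1) sN W1N.
have := Qs _ _ _ _ sNP (stable_hom_in sW2) NPW2.
have := dim_induced_proj W1 sW2; rewrite -/N -/P.
rewrite dNP !dim_induced_hom // !dim_hom_in.
set x1 := \dim (induced L phi rho W1); set x2 := \dim (induced L phi rho W2).
set y1 := \dim _; set y2 := \dim _; set p := \dim {:M}.
move=> jump b2 b1.
have x12 : (x1 <= x2)%N by apply/dimvS/inducedS.
have lt : (x2 * f + s.+1 * \dim W1 < x1 * f + s.+1 * \dim W2)%N.
  suff : (p * (x2 * f + s.+1 * \dim W1) < p * (x1 * f + s.+1 * \dim W2))%N.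
    by case: (p) => [//|p']; rewrite ltn_pmul2l.
  have jumpf : (y1 * f <= y2 * f + d * f)%N by rewrite -mulnDl leq_mul2r jump orbT.
  rewrite [(p * (x2 * f + _))%N]mulnDr [(p * (x1 * f + _))%N]mulnDr.
  rewrite ![(p * (_ * f))%N]mulnA ![(p * (s.+1 * _))%N]mulnCA.
  move: b1 b2 jumpf ds; rewrite [(s.+1 * (\dim N).+1)%N]mulnS.
  move: (y1 * f)%N (y2 * f)%N (d * f)%N (p * x1 * f)%N (p * x2 * f)%N.
  move: (s.+1 * _)%N (s.+1 * (p * _))%N (s.+1 * (p * _))%N; clear; lia.
(* With $w$ the codimension and $f = f' w$, the strict $x f < (s+1) w$ becomes $x f' < s+1$, that
   is, the bound for [s]. *)
have /dvdnP[f' fE] : (\dim W2 - \dim W1 %| f)%N.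
  by apply: dvdn_fact; rewrite subn_gt0 dWlt leq_subLR.
move: lt fE; rewrite -(subnKC (ltnW dWlt)) -(subnKC x12).
move: (\dim W2 - \dim W1)%N (x2 - x1)%N => w x lt fE.
rewrite addKn in fE.
have : (x * f < s.+1 * w)%N.
  by rewrite mulnDl mulnDr -addnA ltn_add2l addnC ltn_add2l in lt.
rewrite [in X in (X < _)%N]fE mulnA ltn_mul2r ltnS => /andP[_ le].
rewrite mulnDl mulnDr -addnA leq_add2l addnC leq_add2l.
by rewrite [in X in (X <= _)%N]fE mulnA leq_mul2r le orbT.
Qed.

Lemma induced_jump (M : vectType k) (rho : repr H M) (W1 W2 : {vspace M}) :
  stable rho K W1 -> stable rho K W2 -> (W1 <= W2)%VS ->
  (\dim (induced L phi rho W2) + d * \dim W1 <=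
   \dim (induced L phi rho W1) + d * \dim W2)%N.
Proof.
move=> sW1 sW2 W12.
(* Descend by units from the trivial bound at [\dim L * f + d * f]; the steps are allowed as long as
   the target is at least [d * f]. *)
have down j : jump_bound (d * f + j) -> jump_bound (d * f).
  elim: j => [|j IHj]; rewrite ?addn0 // addnS => Qj.
  by apply/IHj/jump_bound_step => //; apply: leq_addr.
have Q : jump_bound (d * f).
  by apply: (down (\dim L * f)%N); rewrite addnC; apply: jump_bound_trivial.
have := Q _ _ _ _ sW1 sW2 W12.
rewrite ![(d * f * _)%N]mulnAC -!mulnDl leq_mul2r => /orP[/eqP f0|//].
by have := fact_gt0 m; rewrite -/f f0.
Qed.

(** * The dimension formula *)

Lemma stableS (M : vectType k) (rho : repr H M) (W : {vspace M}) :
  stable rho L W -> stable rho K W.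
Proof. by move=> sW a w /(subvP sKL); apply: sW. Qed.

Lemma stable0 (M : vectType k) (rho : repr H M) (A : {vspace H}) :
  stable rho A 0%VS.
Proof. by move=> a w _; rewrite !memv0 => /eqP ->; rewrite linear0. Qed.

(** The jump from [0] to [W] gives the upper bound; the jump from [W] to [W'], whose induced
    dimension is known from [induced_stable], gives the lower one. *)
Lemma dim_induced (M : vectType k) (rho : repr H M) (W W' : {vspace M}) :
  stable rho K W -> stable rho L W' -> (W <= W')%VS ->
  \dim (induced L phi rho W) = (d * \dim W)%N.
Proof.
move=> sW sW' WW'; case: cphi => cL phic _ _.
have i0 : \dim (induced L phi rho 0) = 0%N.
  by apply/eqP; have := dim_induced_le L phi rho 0; rewrite dimv0 muln0 leqn0.
have i1 : \dim (induced L phi rho W') = (d * \dim W')%N.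
  by rewrite (induced_stable coL SL cL phic sW') dim_ffun_in.
have := induced_jump (@stable0 _ rho K) sW (sub0v W).
have := induced_jump sW (stableS sW') WW'.
rewrite i0 i1 dimv0 muln0 addn0 add0n addnC leq_add2r => b1 b2.
by apply/eqP; rewrite eqn_leq b1 b2.
Qed.

(** On [L] the counit kills $LK^+$, hence is a combination of the [phi i]; so $h = \sum
    \epsilon(h_1) h_2$ is a combination of the [hit (phi i) h]. *)
Lemma hit_inj h : h \in L -> (forall i, hit (phi i) h = 0) -> h = 0.
Proof.
move=> hL h0; case: cphi => cL phic phi0 cQ.
have eps a : a \in L ->
    counit a = \sum_i (phi i a : k) *: (counit (c i) : k^o).
  move=> aL; have /eqP : counit (a - \sum_i (phi i a : k) *: c i) = 0.
    apply/eqP; rewrite -memv_ker; apply: subvP (cQ a aL); apply/prodvP => x y _.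
    by rewrite augP memv_ker => /andP[_ /eqP y0]; rewrite counitM y0 mulr0.
  rewrite linearB subr_eq0 linear_sum => /eqP ->.
  by apply: eq_bigr => i _; apply: linearZ.
rewrite -(hit_counit h) /hit.
pose g i (a b : H) : H := (counit (c i) : k) *: ((phi i a : k) *: b).
transitivity (\sum_i sw (g i) h).
  have [r rL rE] := subcoalgebra_dec coL hL.
  rewrite rE; last exact: bilin_hit.
  have gE i : sw (g i) h = \sum_(p <- r) g i p.1 p.2.
    by apply: rE; split=> x; rewrite /g; lin.
  under [RHS]eq_bigr => i _ do rewrite gE.
  rewrite exchange_big big_seq_cond [RHS]big_seq_cond /=.
  apply: eq_bigr => p /andP[/rL[pL _] _]; rewrite eps // scaler_suml.
  by apply: eq_bigr => i _; rewrite /g scalerA mulrC.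
apply: big1 => i _; rewrite /g.
rewrite -(sw_comp (g := fun x => (counit (c i) : k) *: x)); last by lin.
by rewrite -/(hit _ _) h0 scaler0.
Qed.

(** In the regular representation, inducing [K] gives the image of [L] under [ind_map phi rho 1],
    which is injective on [L] by [hit_inj]. *)
Lemma dim_cobasis : \dim L = (d * \dim K)%N.
Proof.
pose rho : repr H H := regular_repr H.
have rhoE a x : rho a x = a * x by rewrite /= lfunE.
have sK : stable rho K K by move=> a x aK xK; rewrite rhoE KK.
have sL : stable rho L L by move=> a x aL xL; rewrite rhoE LL.
rewrite -(dim_induced sK sL sKL).
have -> : induced L phi rho K = (ind_map phi rho 1 @: L)%VS.
  apply/eqP; rewrite eqEsubv; apply/andP; split.
    apply: induced_sub => x h xK hL; rewrite -[x]mulr1 -rhoE -ind_map_mulr //.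
    by apply/memv_img/LL => //; apply: subvP xK.
  by apply/subvP => _ /memv_imgP[h hL ->]; apply: mem_induced.
rewrite limg_dim_eq //; apply/eqP; rewrite -subv0; apply/subvP => h.
rewrite memv_cap memv_ker memv0 => /andP[hL /eqP h0]; apply/eqP/hit_inj => // i.
by have := ind_mapE phi rho 1 h i; rewrite h0 ffunE rhoE mulr1.
Qed.

End Freeness.

(** * Flags of left ideals *)

Lemma addvCA (k : fieldType) (V : vectType k) (U W X : {vspace V}) :
  (U + (W + X) = W + (U + X))%VS.
Proof. by rewrite !addvA [(U + W)%VS]addvC. Qed.

Section Eigen.
Variables (k : closedFieldType) (A : falgType k).

Lemma closed_field_annihil (h : A) :
  exists r : seq k, \prod_(z <- r) (h - z%:A) = 0.
Proof.
(* Polynomials of size at most [n] form a space of dimension larger than that of [A], so a nonzero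
   one annihilates [h]. *)
pose n := (\dim {:A}).+1.
pose f (r : 'rV[k]_n) : A := horner_alg h (rVpoly r).
have lf : linear f.
  by move=> c x y; rewrite /f !linearD !linearZ /= mulr_algl.
have kf : lker (linfun f) != 0%VS.
  rewrite -dimv_eq0 -lt0n.
  have := limg_ker_dim (linfun f) fullv; rewrite capfv dimvf /dim /= mul1n => E.
  by rewrite -(ltn_add2r (\dim (limg (linfun f)))) add0n E ltnS dimvS ?subvf.
pose r := vpick (lker (linfun f)).
have r0 : rVpoly r != 0.
  apply: contraNneq kf => r0; rewrite -vpick0 -/r.
  by rewrite -[r]rVpolyK r0 linear0.
have := memv_pick (lker (linfun f)); rewrite memv_ker (linfun_linE _ lf) /f -/r.
have [s sE] := closed_field_poly_normal (rVpoly r).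
rewrite sE linearZ /= mulr_algl scaler_eq0 lead_coef_eq0 (negPf r0) /= rmorph_prod.
move=> /eqP p0; exists s; rewrite -{}p0; apply: eq_bigr => z _.
by rewrite rmorphB /= horner_algX horner_algC.
Qed.

(** Apply the linear factors of an annihilating polynomial to [x] one by one; the last value outside
    [Q1] is an eigenvector modulo [Q1]. *)
Lemma eigenvector_mod (Q1 Q2 : {vspace A}) (h : A) :
  (forall x, x \in Q2 -> h * x \in Q2) -> ~~ (Q2 <= Q1)%VS ->
  exists z, exists2 x, x \in Q2 & x \notin Q1 /\ (h - z%:A) * x \in Q1.
Proof.
move=> hQ2 /subvPn[x x2 x1]; have [r r0] := closed_field_annihil h.
have : \prod_(z <- r) (h - z%:A) * x \in Q1 by rewrite r0 mul0r mem0v.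
have hz z y : y \in Q2 -> (h - z%:A) * y \in Q2.
  by move=> yQ; rewrite mulrBl -scalerAl mul1r rpredB ?rpredZ ?hQ2.
elim: r {r0} => [|z r IHr]; first by rewrite big_nil mul1r (negPf x1).
rewrite big_cons -mulrA; set y := _ * x => y1.
have [/IHr //|yN1] := boolP (y \in Q1).
exists z, y => //; rewrite /y big_seq_cond.
elim/big_rec: _ => [|t u _ uQ]; first by rewrite mul1r.
by rewrite -mulrA hz.
Qed.
End Eigen.

Section Flag.
Variables (k : closedFieldType) (H : hopfType k) (K L : {vspace H}).
Hypothesis (hopfL : hopf_subalgebra L).
Hypothesis (sKL : (K <= L)%VS).
Hypothesis (comLK : commutative_quotient K L).

Let Q := (L * augmentation_ideal K)%VS.

Let LL : {in L &, forall a b, a * b \in L}.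
Proof. by case: hopfL => _ /subvP s _ _ a b aL bL; apply/s/memv_mul. Qed.

Let QL : (Q <= L)%VS.
Proof.
by apply/prodvP => a b aL /memv_capP[bK _]; apply: LL => //; apply: subvP bK.
Qed.

Definition left_ideal (S : {vspace H}) :=
  forall a x, a \in L -> x \in S -> a * x \in S.

Let lQ : left_ideal Q.
Proof.
have := prodvSl (augmentation_ideal K) (_ : (L * L <= L)%VS).
rewrite -prodvA => /(_ _)/subvP sQ a x aL xQ; apply: sQ; last exact: memv_mul.
by apply/prodvP.
Qed.

(* Left multiplications by elements of [L] commute modulo [L K^+] although    *)
(* [L K^+] is only a left ideal.                                              *)
Lemma commutator_mod a b x : a \in L -> b \in L -> x \in L ->
  a * (b * x) - b * (a * x) \in Q.
Proof.
move=> aL bL xL.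
have -> : a * (b * x) - b * (a * x) =
    (a * (b * x) - b * x * a) + b * (x * a - a * x).
  by rewrite mulrBr !mulrA addrA subrK.
by rewrite rpredD ?lQ ?comLK ?LL.
Qed.

(** The eigenspace [S3] of [h] modulo [S] inside [S2] is again a left ideal, because commutators
    fall in $Q \subseteq S$; the rest of [hs] then has a common eigenvector in it. *)
Lemma common_eigenspace_mod (hs : seq H) (S S2 : {vspace H}) :
  {subset hs <= L} -> (Q <= S)%VS -> left_ideal S -> left_ideal S2 ->
  (S2 <= L)%VS -> ~~ (S2 <= S)%VS ->
  exists2 c, c \in S2 & c \notin S /\ {in hs, forall h, h * c \in (<[c]> + S)%VS}.
Proof.
move=> + QS lS; elim: hs S2 => [|h hs IHhs] S2 hL l2 S2L S2S.
  by case/subvPn: S2S => c c2 cS; exists c.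
have hhL : h \in L by apply: hL; rewrite mem_head.
have [||z [x x2 [xS xE]]] := @eigenvector_mod _ _ S S2 h => //.
  by move=> x; apply: l2.
pose S3 := (S2 :&: amull (h - z%:A) @^-1: S)%VS.
have S3P y : (y \in S3) = (y \in S2) && ((h - z%:A) * y \in S).
  by rewrite memv_cap -memv_preim lfunE.
have [||||c c3 [cS cE]] := IHhs S3.
- by move=> y yhs; apply: hL; rewrite in_cons yhs orbT.
- move=> a y aL; rewrite !S3P => /andP[y2 yS]; rewrite l2 //=.
  have -> : (h - z%:A) * (a * y) =
      a * ((h - z%:A) * y) + (h * (a * y) - a * (h * y)).
    rewrite !mulrBl mulrBr -!scalerAl !mul1r -scalerAr.
    by rewrite [RHS]addrC subrKA.
  apply: rpredD; first exact: lS.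
  by apply: (subvP QS); apply: commutator_mod => //; apply: (subvP S2L).
- by apply: subv_trans S2L; apply: capvSl.
- by apply/subvPn; exists x; rewrite // S3P x2.
move: c3; rewrite S3P => /andP[c2 hc]; exists c => //; split=> // y.
rewrite in_cons => /orP[/eqP ->|]; last exact: cE.
rewrite -[h](subrK z%:A) mulrDl addrC memv_add //.
by rewrite -scalerAl mul1r memvZ // memv_line.
Qed.

(** A chain of left ideals of [L] starting at [Q], with successive quotients lines on which [L] acts
    by characters; the head of the list is adjoined last. *)
Fixpoint flag (s : seq H) : Prop := if s is c :: s' then
  [/\ c \in L, c \notin (Q + <<s'>>)%VS,
      {in L, forall h, h * c \in (<[c]> + (Q + <<s'>>))%VS} & flag s'] else True.

Lemma flag_ideal s : flag s -> left_ideal (Q + <<s>>)%VS.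
Proof.
elim: s => [|c s IHs] /=; first by rewrite span_nil addv0.
move=> [cL _ hc fs] a y aL; rewrite span_cons addvCA.
move=> /memv_addP[u /vlineP[z ->] [v vS ->]].
rewrite mulrDr rpredD // -?scalerAr ?rpredZ ?hc //.
by apply: (subvP (addvSr _ _)); apply: IHs.
Qed.

Lemma flag_sub s : flag s -> (Q + <<s>> <= L)%VS.
Proof.
elim: s => [|c s IHs] /=; first by rewrite span_nil addv0.
move=> [cL _ hc fs]; rewrite span_cons addvCA subv_add IHs // andbT.
by rewrite -memvE.
Qed.

Lemma flag_mul s j h : flag s -> (j < size s)%N -> h \in L ->
  h * s`_j \in (Q + <<drop j s>>)%VS.
Proof.
move=> + + hL; elim: s j => // c s IHs [|j] /= [_ _ hc fs]; last first.
  by rewrite ltnS; apply: IHs.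
by move=> _; rewrite span_cons addvCA; apply: hc.
Qed.

Lemma exists_flag : exists2 s, flag s & (Q + <<s>>)%VS = L.
Proof.
suff main n s : flag s -> (\dim L - \dim (Q + <<s>>) <= n)%N ->
    exists2 s', flag s' & (Q + <<s'>>)%VS = L.
  exact: (main _ [::] I (leqnn _)).
elim: n s => [|n IHn] s fs dn.
  exists s => //; apply/eqP; rewrite eqEdim flag_sub //.
  by rewrite -subn_eq0 -leqn0.
have [LS|LS] := boolP (L <= Q + <<s>>)%VS.
  by exists s => //; apply/eqP; rewrite eqEsubv flag_sub.
have [||||||c cL [cS cE]] := @common_eigenspace_mod (vbasis L) (Q + <<s>>)%VS L.
- by move=> x; apply: vbasis_mem.
- exact: addvSl.
- exact: flag_ideal.
- by move=> a x aL xL; apply: LL.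
- exact: subvv.
- by [].
have fcs : flag (c :: s).
  split=> // h hL; rewrite (coord_vbasis hL) mulr_suml; apply: memv_suml => i _.
  rewrite -scalerAl memvZ // cE //; apply: mem_nth.
  by rewrite size_tuple.
apply: (IHn _ fcs); rewrite span_cons addvCA.
have : (\dim (Q + <<s>>) < \dim (<[c]> + (Q + <<s>>)))%N.
  rewrite ltn_neqAle dimvS ?addvSr // andbT; apply/negP => /eqP dE.
  case/negP: cS; suff /eqP -> : (Q + <<s>> == <[c]> + (Q + <<s>>))%VS.
    by apply: (subvP (addvSl _ _)); apply: memv_line.
  by rewrite eqEdim addvSr dE leqnn.
move=> XY; apply: leq_trans (leq_sub2l _ XY) _.
by rewrite subnS; case: (_ - _)%N dn.
Qed.

(** In a basis adapted to a full flag, [L] acts on $L/LK^+$ by triangular matrices. *)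
Lemma flag_cobasis : exists d (c : 'I_d -> H) (phi : 'I_d -> 'Hom(H, k^o)),
  cobasis K L c phi /\
  forall h (i j : 'I_d), h \in L -> (i < j)%N -> phi i (h * c j) = 0.
Proof.
have [s fs sL] := exists_flag.
(* [p] models the quotient map by [Q], so coordinates of [p x] are functionals vanishing on [Q]. *)
pose p : 'End(H) := (\1 - projv Q)%VF.
have pE x : p x = x - projv Q x by rewrite add_lfunE opp_lfunE id_lfunE.
have p0 x : (p x == 0) = (x \in Q).
  apply/eqP/idP => [/eqP|xQ]; last by rewrite pE projv_id ?subrr.
  by rewrite pE subr_eq0 => /eqP ->; apply: memv_proj.
have span_p t x : p x \in <<map p t>>%VS -> x \in (Q + <<t>>)%VS.
  rewrite -limg_span => /memv_imgP[y yt xy].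
  rewrite -[x](subrK y) memv_add // -p0 linearB /= xy subrr //.
have freep t : flag t -> free (map p t).
  elim: t => [|c t IHt] /=; first by rewrite nil_free.
  move=> [_ cS _ ft]; rewrite free_cons IHt // andbT.
  by apply: contra cS; apply: span_p.
pose X := map_tuple p (in_tuple s).
pose phi (i : 'I_(size s)) : 'Hom(H, k^o) :=
  linfun (fun x => coord X i (p x) : k^o).
have phiE i x : phi i x = coord X i (p x).
  by rewrite linfun_linE // => c u v; rewrite !linearP.
have phi0 i x : x \in Q -> phi i x = 0.
  by rewrite -p0 phiE => /eqP ->; rewrite linear0.
have phis (i : 'I_(size s)) (j : nat) : (j < size s)%N ->
    phi i s`_j = (nat_of_ord i == j)%:R.
  move=> js; rewrite phiE.
  have -> : p s`_j = X`_(Ordinal js) by rewrite (nth_map 0).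
  by rewrite coord_free ?freep // -val_eqE eq_sym.
exists (size s), (fun i => s`_i), phi; split.
  split=> [i|i j|i h|h hL]; [|by rewrite phis|exact: phi0|].
    apply: (subvP (flag_sub fs)); apply: (subvP (addvSr _ _)).
    by apply: memv_span; apply: mem_nth; apply: ltn_ord.
  move: hL; rewrite -{1}sL => /memv_addP[q qQ [u us ->]].
  have {us}[a uE] : exists a : 'I_(size s) -> k, u = \sum_i a i *: s`_i.
    have uE := coord_span (us : u \in <<in_tuple s>>%VS).
    by eexists; exact: uE.
  have phia i : phi i (q + u) = a i.
    rewrite linearD /= phi0 // add0r uE linear_sum (bigD1 i) //= linearZ /=.
    rewrite phis // eqxx big1 => [|j ji]; first by rewrite addr0; apply: mulr1.
    rewrite linearZ /= phis // -(inj_eq val_inj) in ji *.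
    by rewrite eq_sym (negPf ji) scaler0.
  by under eq_bigr do rewrite phia; rewrite -uE addrK.
move=> h i j hL ij.
(* As the head is adjoined last, $h c_j$ involves only [Q] and the entries of [s] from index [j]
   on. *)
suff [q qQ [u us ->]] : exists2 q, q \in Q & exists2 u,
    u \in <<drop j s>>%VS & h * s`_j = q + u.
  rewrite linearD /= phi0 // add0r.
  have /subvP/(_ u us) : (<<drop j s>> <= lker (phi i))%VS.
    apply/span_subvP => x /(nthP 0)[l]; rewrite size_drop nth_drop => ls <-.
    rewrite memv_ker phis; last by rewrite -ltn_subRL.
    by rewrite ltn_eqF // (leq_trans ij) // leq_addr.
  by rewrite memv_ker => /eqP.
apply/memv_addP.
exact: flag_mul.
Qed.

End Flag.

(** * Divisibility *)

Section Divisibility.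
Variables (k : fieldType) (H : hopfType k) (K L : {vspace H}).
Hypotheses (hopfK : hopf_subalgebra K) (hopfL : hopf_subalgebra L).
Hypothesis (sKL : (K <= L)%VS).
Variables (d : nat) (c : 'I_d -> H) (phi : 'I_d -> 'Hom(H, k^o)).
Hypothesis cphi : cobasis K L c phi.
Hypothesis phi_flag : forall h (i j : 'I_d), h \in L -> (i < j)%N ->
  phi i (h * c j) = 0.

Let LL : {in L &, forall a b, a * b \in L}.
Proof. by case: hopfL => _ /subvP s _ _ a b aL bL; apply/s/memv_mul. Qed.
Let coL : subcoalgebra L. Proof. by case: hopfL. Qed.
Let cL i : c i \in L. Proof. by case: cphi. Qed.
Let SL : {in L, forall a, antipode a \in L}.
Proof. by case: hopfL => _ _ _ /subvP s a aL; apply/s/memv_img. Qed.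

(** Matrix coefficients of [L] acting on $L/LK^+$ in the basis [c], triangular by [phi_flag]. *)
Definition twist i j : 'Hom(H, k^o) := (phi i \o amulr (c j))%VF.

Lemma twistE i j h : twist i j h = phi i (h * c j).
Proof. by rewrite comp_lfunE lfunE. Qed.

Lemma twist_expand i : {in L &, forall a b : H,
  phi i (a * b) = \sum_j (phi j b : k) * (twist i j a : k)}.
Proof.
move=> a b aL bL; case: cphi => _ _ phi0 cQ.
rewrite -{1}[b](subrK (\sum_j (phi j b : k) *: c j)) mulrDr linearD /=.
rewrite phi0 ?add0r; last first.
  have /subvP : (L * (L * augmentation_ideal K) <= L * augmentation_ideal K)%VS.
    by rewrite prodvA prodvSl //; case: hopfL.
  by apply; apply: memv_mul; last exact: cQ.
rewrite mulr_sumr linear_sum; apply: eq_bigr => j _.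
by rewrite -scalerAr linearZ /= twistE.
Qed.

(** Coordinate form of the diagonal action of [g] on $(L/LK^+) \otimes V$. *)
Lemma hit_mul i g h : g \in L -> h \in L ->
  hit (phi i) (g * h) = \sum_j hit (twist i j) g * hit (phi j) h.
Proof.
move=> gL hL; rewrite /hit swM; last exact: bilin_hit.
have [r rL rE] := subcoalgebra_dec coL gL.
have [s sL sE] := subcoalgebra_dec coL hL.
rewrite rE; last by split=> x; lin.
transitivity (\sum_(p <- r) \sum_(q <- s)
    (phi i (p.1 * q.1) : k) *: (p.2 * q.2)).
  by apply: eq_bigr => p _; apply: sE; split=> x; lin.
transitivity (\sum_j (\sum_(p <- r) (twist i j p.1 : k) *: p.2) *
                     (\sum_(q <- s) (phi j q.1 : k) *: q.2)); last first.
  apply: eq_bigr => j _.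
  by congr (_ * _); apply/esym; [apply: rE|apply: sE]; apply: bilin_hit.
under [RHS]eq_bigr => j _ do rewrite mulr_suml.
rewrite [RHS]exchange_big big_seq_cond [RHS]big_seq_cond /=.
apply: eq_bigr => p /andP[/rL[p1 _] _].
under [RHS]eq_bigr => j _ do rewrite mulr_sumr.
rewrite [RHS]exchange_big big_seq_cond [RHS]big_seq_cond /=.
apply: eq_bigr => q /andP[/sL[q1 _] _]; rewrite twist_expand // scaler_suml.
by apply: eq_bigr => j _; rewrite -scalerAl -scalerAr scalerA mulrC.
Qed.

(** Diagonal entries of triangular matrices multiply: each [twist i i] is a character of [L]. *)
Lemma twist_mul i : {in L &, forall a b : H,
  twist i i (a * b) = (twist i i a : k) * (twist i i b : k)}.
Proof.
move=> a b aL bL; rewrite twistE -mulrA twist_expand ?LL // (bigD1 i) //=.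
rewrite big1 ?addr0 => [|j ji]; first by rewrite mulrC [twist i i b]twistE.
have [ij|] := ltnP i j; first by rewrite twistE (phi_flag aL ij) mulr0.
rewrite leq_eqVlt (inj_eq val_inj) (negPf ji) /= => lt_ji.
by rewrite (phi_flag bL lt_ji) mul0r.
Qed.

Lemma twist1 i : twist i i 1 = 1.
Proof. by rewrite twistE mul1r; case: cphi => _ -> _ _; rewrite eqxx. Qed.

(** A character $\chi$ has convolution inverse $\chi \circ S$, so twisting by it can be undone. *)
Lemma hit_twistK i h : h \in L ->
  sw (fun a b => (twist i i (antipode a) : k) *: hit (twist i i) b) h = h.
Proof.
move=> hL; set chi := twist i i.
rewrite /hit; under eq_sw => a b.
  rewrite (sw_comp (g := fun x => (chi (antipode a) : k) *: x)); last by lin.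
  over.
rewrite -(sw_assoc (f := fun a c b =>
  (chi (antipode a) : k) *: ((chi c : k) *: b))); try by move=> *; lin.
rewrite -[RHS](sw_counitl h (f := id)) //.
apply: (eq_sw_in coL hL); try by split=> x; lin.
move=> a b aL bL /=.
transitivity ((chi (sw (fun x y => antipode x * y) a) : k) *: b).
  rewrite (sw_comp (g := fun x : H => (chi x : k) *: b)); last by lin.
  apply: (eq_sw_in coL aL); try by split=> x; lin.
  by move=> x y xL yL /=; rewrite scalerA twist_mul ?SL.
by rewrite sw_antipodel linearZ /= twist1 [_ *: 1]mulr1.
Qed.

Variables (V : vectType k) (rho : repr H V).

Definition simple_in (A : {vspace H}) (W : {vspace V}) :=
  [/\ stable rho A W, W <> 0%VS &
    forall W1 : {vspace V}, stable rho A W1 -> (W1 <= W)%VS ->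
      W1 = 0%VS \/ W1 = W].

Variable W : {vspace V}.
Hypothesis simW : simple_in L W.

(** Untwisting with [hit_twistK] makes [Z] an [L]-submodule of the simple [W]. *)
Lemma twist_stable i (Z : {vspace V}) : (Z <= W)%VS ->
  (forall g z, g \in L -> z \in Z -> rho (hit (twist i i) g) z \in Z) ->
  (\dim W %| \dim Z)%N.
Proof.
move=> ZW sZ; case: simW => _ _ min.
have [|//|->|->//] := min Z; last by rewrite dimv0 dvdn0.
move=> h z hL zZ; rewrite -(hit_twistK i hL).
rewrite (sw_comp (g := fun x => rho x z)); last by lin.
apply: (sw_mem coL hL); first by split=> x; apply: linear_app; apply: linear_map; lin.
move=> a b aL bL; rewrite linearZ scale_lfunE memvZ //.
exact: sZ.
Qed.

(** [N t] consists of the elements of [L] whose first [t] coordinates under [ind_map phi rho w]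
    vanish. On [N i] the coordinate [T i] is equivariant for the twist of [W] by the character
    [twist i i], so [T i @: N i] is [0] or [W]; these dimensions add up to that of the image. *)
Lemma dvdn_dim_ind_map w : w \in W -> (\dim W %| \dim (ind_map phi rho w @: L))%N.
Proof.
move=> wW; case: (simW) => sW _ _.
pose T i : 'Hom(H, V) := linfun (fun h => rho (hit (phi i) h) w).
have TE i h : T i h = rho (hit (phi i) h) w.
  by rewrite linfun_linE //; apply: linear_app; apply: linear_map; apply: linear_hit.
pose N t : {vspace H} := (L :&: \bigcap_(i < d | (i < t)%N) lker (T i))%VS.
have NP t h : reflect (h \in L /\ forall i : 'I_d, (i < t)%N -> T i h = 0) (h \in N t).
  rewrite memv_cap; apply: (iffP andP) => [[hL hT]|[hL hT]]; split=> //.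
    move=> i it; apply/eqP; rewrite -memv_ker.
    by apply: subvP hT; apply: bigcapv_inf it _.
  rewrite memvE; apply/subv_bigcapP => i it.
  by rewrite -memvE memv_ker hT.
have Tmul (i : 'I_d) g h : g \in L -> h \in N i ->
    T i (g * h) = rho (hit (twist i i) g) (T i h).
  move=> gL /NP[hL hT]; rewrite !TE hit_mul // linear_sum sum_lfunE.
  rewrite (bigD1 i) //= big1 ?addr0 => [|j ji]; first by rewrite reprM comp_lfunE.
  rewrite reprM comp_lfunE -TE.
  (* For [i < j] the matrix entry vanishes on [L]; for [j < i] the coordinate vanishes on [N i]. *)
  have [ij|] := ltnP i j.
    suff -> : hit (twist i j) g = 0 by rewrite linear0 zero_lfunE.
    have [r rL rE] := subcoalgebra_dec coL gL.
    rewrite /hit rE; last exact: bilin_hit.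
    rewrite big_seq_cond big1 // => p /andP[/rL[pL _] _].
    by rewrite twistE phi_flag ?scale0r.
  rewrite leq_eqVlt (inj_eq val_inj) (negPf ji) /= => lt_ji.
  by rewrite hT // linear0.
have NL t g h : g \in L -> h \in N t -> g * h \in N t.
  move=> gL hN; have [hL hT] := NP _ _ hN; apply/NP; split; first exact: LL.
  move=> i it; rewrite Tmul // ?hT ?linear0 //.
  by apply/NP; split=> // j ji; apply: hT; apply: ltn_trans it.
have dvdN t : (t <= d)%N -> (\dim W %| \dim L - \dim (N t))%N.
  elim: t => [|t IHt] td.
    suff -> : N 0%N = L by rewrite subnn dvdn0.
    apply/vspaceP => h; apply/NP/idP => [[]//|hL]; split=> //.
  pose i := Ordinal td.
  have NS : N t.+1 = (N t :&: lker (T i))%VS.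
    apply/vspaceP => h; rewrite memv_cap memv_ker; apply/NP/andP.
      move=> [hL hT]; split; last by rewrite hT.
      by apply/NP; split=> // j jt; apply: hT; apply: ltnW.
    move=> [/NP[hL hT] /eqP Th]; split=> // j; rewrite ltnS leq_eqVlt.
    by move=> /orP[/eqP ji|/hT//]; rewrite (_ : j = i) //; apply: val_inj.
  have NtL : (\dim (N t) <= \dim L)%N by apply/dimvS/capvSl.
  have <- : (\dim L - \dim (N t) + \dim (T i @: N t))%N = (\dim L - \dim (N t.+1))%N.
    rewrite NS -(limg_ker_dim (T i) (N t)) in NtL *.
    by move: NtL; clear; lia.
  rewrite dvdn_add ?IHt // 1?ltnW //; apply: (@twist_stable i).
    apply/subvP => _ /memv_imgP[h /NP[hL _] ->]; rewrite TE.
    by apply: sW => //; apply: hit_mem.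
  move=> g _ gL /memv_imgP[h hN ->]; rewrite -Tmul //.
  by apply: memv_img; apply: NL.
have := dvdN d (leqnn d).
rewrite -(limg_ker_dim (ind_map phi rho w) L).
suff -> : (L :&: lker (ind_map phi rho w))%VS = N d by rewrite addKn.
apply/vspaceP => h; rewrite memv_cap memv_ker; apply/andP/NP.
  move=> [hL /eqP h0]; split=> // i _.
  by rewrite TE -(ind_mapE phi rho w h i) h0 ffunE.
move=> [hL hT]; split=> //; apply/eqP/ffunP => i.
by rewrite ind_mapE -TE hT // ffunE.
Qed.

(** By simplicity $W_1 = Kw$, so the induced module is generated by $1 \otimes w$ and
    [dvdn_dim_ind_map] applies. *)
Lemma dvdn_dim_simple W1 : simple_in K W1 -> (W1 <= W)%VS ->
  (\dim W %| d * \dim W1)%N.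
Proof.
move=> [sW1 nz1 min1] W1W; case: (simW) => sW _ _.
rewrite -(dim_induced hopfK hopfL sKL cphi sW1 sW W1W).
have w1 := memv_pick W1; set w := vpick W1 in w1.
have w0 : w != 0 by rewrite vpick0; apply/eqP.
suff -> : induced L phi rho W1 = (ind_map phi rho w @: L)%VS.
  by apply: dvdn_dim_ind_map; apply: (subvP W1W).
have [K1 KK _ _] := hopfK.
have lw : linear (fun a => rho a w) by lin.
pose Kw := (linfun (fun a => rho a w) @: K)%VS.
have -> : W1 = Kw.
  have [||Kw0|//] := min1 Kw.
  - move=> a _ aK /memv_imgP[b bK ->]; rewrite (linfun_linE _ lw) -comp_lfunE.
    rewrite -reprM -(linfun_linE _ lw); apply: memv_img.
    by apply: (subvP KK); apply: memv_mul.
  - apply/subvP => _ /memv_imgP[b bK ->]; rewrite (linfun_linE _ lw).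
    exact: sW1.
  have := memv_img (linfun (fun a => rho a w)) K1.
  by rewrite -/Kw Kw0 memv0 (linfun_linE _ lw) repr1 id_lfunE (negPf w0).
apply/eqP; rewrite eqEsubv; apply/andP; split.
  apply: induced_sub => _ h /memv_imgP[b bK ->] hL; rewrite (linfun_linE _ lw).
  rewrite -(ind_map_mulr hopfK hopfL cphi) //; apply: memv_img.
  by apply: LL => //; apply: (subvP sKL).
apply/subvP => _ /memv_imgP[h hL ->]; apply: mem_induced => //.
have := memv_img (linfun (fun a => rho a w)) K1.
by rewrite (linfun_linE _ lw) repr1 id_lfunE.
Qed.

End Divisibility.

(** * Climbing the series *)

Lemma exists_simple (k : fieldType) (H : hopfType k) (V : vectType k)
    (rho : repr H V) (A : {vspace H}) (W : {vspace V}) :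
  stable rho A W -> W <> 0%VS ->
  exists2 W1, simple_in rho A W1 & (W1 <= W)%VS.
Proof.
have [n] := ubnP (\dim W); elim: n W => // n IHn W; rewrite ltnS => dW sW nzW.
(* Having a proper nonzero stable subspace is not a boolean condition, hence the excluded middle. *)
case: (classic (exists W1, [/\ stable rho A W1, (W1 <= W)%VS, W1 <> 0%VS & W1 <> W])).
  move=> [W1 [sW1 W1W nz1 ne1]].
  have [|//|//|W2 simW2 W21] := IHn W1.
    apply: leq_trans dW; rewrite ltn_neqAle dimvS // andbT.
    by apply: contra_notN ne1 => dE; apply/eqP; rewrite eqEdim W1W (eqP dE) leqnn.
  by exists W2 => //; apply: subv_trans W1W.
move=> none; exists W; last exact: subvv.
split=> // W1 sW1 W1W.
have [->|/eqP nz1] := eqVneq W1 0%VS; first by left.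
have [->|/eqP ne1] := eqVneq W1 W; first by right.
by case: none; exists W1.
Qed.

Lemma dvdn_dim_chain (k : closedFieldType) (H : hopfType k) (K L : {vspace H})
    (V : vectType k) (rho : repr H V) (W : {vspace V}) :
  hopf_subalgebra K -> hopf_subalgebra L -> (K <= L)%VS ->
  commutative_quotient K L ->
  (forall W1, simple_in rho K W1 -> (\dim W1 %| \dim K)%N) ->
  simple_in rho L W -> (\dim W %| \dim L)%N.
Proof.
move=> hopfK hopfL sKL comLK dvdK simW.
have [d [c [phi [cphi flag_phi]]]] := flag_cobasis hopfL sKL comLK.
case: (simW) => sW nzW _.
have [W1 simW1 W1W] := exists_simple (stableS sKL sW) nzW.
rewrite (dim_cobasis hopfK hopfL sKL cphi).
apply: dvdn_trans (dvdn_dim_simple hopfK hopfL sKL cphi flag_phi simW simW1 W1W) _.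
by rewrite dvdn_mul // dvdK.
Qed.

Theorem theorem1p3 (k : closedFieldType) (H : hopfType k)
    (ssH : semisimple_algebra H) (solvH : lower_solvable H) :
  frobenius_type H.
Proof.
move=> V rho [sV nzV minV]; case: solvH => t [F [F0 Ft hopfF stepF]].
(* The claim concerns all simple [F i]-submodules of the fixed [V]; for [i = t] it applies to [V]
   itself. *)
suff main i : (i <= t)%N -> forall W, simple_in rho (F i) W ->
    (\dim W %| \dim (F i))%N.
  rewrite -Ft; apply: main => //; split=> //.
    by move=> a w _ _; apply: memvf.
  move=> W sW; apply: (minV W) => a; apply/subvP => _ /memv_imgP[w wW ->].
  by apply: sW; rewrite ?Ft ?memvf.
(* Over [F 0], which is the line of scalars, every line is stable, so a simple submodule has
   dimension 1. *)
elim: i => [_ W [sW nzW minW]|i IHi it W simW].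
  have w0 : vpick W != 0 by rewrite vpick0; apply/eqP.
  rewrite F0 in sW minW *; have [|||<-] := minW <[vpick W]>%VS.
  - move=> _ w /vlineP[a ->] wl; rewrite linearZ /= repr1 scale_lfunE id_lfunE.
    exact: memvZ.
  - exact: memv_pick.
  - by move=> /eqP; rewrite -dimv_eq0 dim_vline w0.
  - by rewrite dim_vline w0 dvd1n.
have [[sF _] comF] := stepF i it.
apply: (dvdn_dim_chain (hopfF i (ltnW it)) (hopfF _ it) sF comF) simW.
by apply: IHi; apply: ltnW.
Qed.
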